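(* Let $a,b,\nu>0$ and $\mu>\frac12$. Then the function $$x\mapsto\chi_{\mu,\nu,a,b}(x)=\frac{2^{\mu-\nu+1}\Gamma(\mu+1)b^{\nu}}{a^{\mu}\Gamma(\nu)}\,e^{-a\sqrt{x}}x^{\frac{\nu-\mu}{2}}I_{\mu}(a\sqrt{x})K_{\nu}(b\sqrt{x}),\qquad x>0,$$ is the Laplace transform of an infinitely divisible distribution on $(0,\infty)$.
   Context: $I_\mu$ and $K_\nu$ are the modified Bessel functions of the first and second kinds, and $\Gamma$ is the Euler gamma function. The Laplace transform of a probability distribution $\lambda$ on $[0,\infty)$ is $x\mapsto\int_0^\infty e^{-xt}d\lambda(t)$. A probability distribution $\lambda$ on $[0,\infty)$ is infinitely divisible if for every $n\in\mathbb{N}$ there is a probability distribution $\lambda_n$ on $[0,\infty)$ with $\int_0^\infty e^{-xt}d\lambda(t)=\left[\int_0^\infty e^{-xt}d\lambda_n(t)\right]^n$ for all $x>0$. *)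

(* Defs.v *)
From mathcomp Require Import all_boot all_order all_algebra.
From mathcomp Require Import all_classical all_reals all_analysis.

Set Implicit Arguments.
Unset Strict Implicit.
Unset Printing Implicit Defensive.

Import Order.TTheory GRing.Theory Num.Theory.
Import numFieldNormedType.Exports.

Local Open Scope classical_set_scope.
Local Open Scope ring_scope.

Definition euler_integral (R : realType) (s : R) : R :=
  \int[@lebesgue_measure R]_(t in `]0, +oo[) (t `^ (s - 1) * expR (- t)).

Definition Gamma_shift (R : realType) (s : R) : nat :=
  if 0 < s then 0 else (Num.truncn (- s)).+1.

(* Euler's integral for 0 < s, extended to s <= 0 by the functional equation
   Gamma (s + 1) = s * Gamma s: the shift is the least n with 0 < s + n.
   At the poles 0, -1, -2, ... the product contains the factor 0, so that
   Gamma s = 0 and hence (Gamma s)^-1 = 0, which is the correct value of the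
   entire function 1 / Gamma. *)
Definition Gamma (R : realType) (s : R) : R :=
  let n := Gamma_shift s in
  euler_integral (s + n%:R) / \prod_(i < n) (s + i%:R).

(* Meant for 0 < x, with an arbitrary real order mu. *)
Definition besselI (R : realType) (mu x : R) : R :=
  limn (series (fun k : nat =>
    (x / 2) `^ (k.*2%:R + mu) / (k`!%:R * Gamma (k%:R + mu + 1)))).

Definition besselK_nonint (R : realType) (nu x : R) : R :=
  pi / 2 * ((besselI (- nu) x - besselI nu x) / sin (nu * pi)).

(* At integer orders the quotient is 0 / 0 and K is the limit in the order. *)
Definition besselK (R : realType) (nu x : R) : R :=
  if nu \is a Num.int then lim (besselK_nonint s x @[s --> nu^'])
  else besselK_nonint nu x.

Definition laplace (R : realType) (P : probability (measurableTypeR R) R) (x : R) : R :=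
  \int[P]_(t in `[0, +oo[) expR (- (x * t)).

Definition infinitely_divisible (R : realType) (P : probability (measurableTypeR R) R) : Prop :=
  forall n : nat, (0 < n)%N ->
    exists Q : probability (measurableTypeR R) R,
      Q `[0, +oo[%classic = 1%E /\
      forall x : R, 0 < x -> laplace P x = laplace Q x ^+ n.

Definition chi (R : realType) (mu nu a b x : R) : R :=
  2 `^ (mu - nu + 1) * Gamma (mu + 1) * b `^ nu / (a `^ mu * Gamma nu)
  * expR (- (a * Num.sqrt x)) * x `^ ((nu - mu) / 2)
  * besselI mu (a * Num.sqrt x) * besselK nu (b * Num.sqrt x).

(* Main.v *)
From HB Require Import structures.
Require Import Defs.
From mathcomp Require Import all_boot all_order all_algebra.
From mathcomp Require Import all_classical all_reals all_analysis.
From mathcomp Require Import measurable_realfun.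
From mathcomp Require Import ring lra.

(* In terms of the entire function [B_m y = sum_k y ^ k / (k! Gamma (k + m + 1))] and of
   [M_s y = int_0^oo t ^ (s - 1) exp (- t - y / t) dt], the function [chi] is the product of
   [Gamma (mu + 1) exp (- a sqrt x) B_mu (a ^ 2 x / 4)] and [M_nu (b ^ 2 x / 4) / Gamma nu],
   and both factors tend to 1 at [0+].  By Bernstein's theorem it suffices that [- ln chi] has
   completely monotone increments: every root [chi ^ (1 / n)] is then completely monotone,
   hence a Laplace transform.  There is no atom at [0] because [chi x = O (1 / x)].

   Both logarithms come from first-order systems in an auxiliary scale parameter: if
   [f' = P E] and [E' = x Q f] with [P, Q >= 0], the normalized Wronskian at [x] and [x + d] is
   the integral of products of ratios [f t / f b], so complete monotonicity of these ratios and
   of the increments of [E / f] bootstrap each other.  This gives the [M_nu] factor, and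
   the ratios [B_mu (r x) / B_mu (r' x)] for [r <= r'].  For the other factor, put
   [c = mu + 1 / 2], [u s = s ^ c B_mu (s ^ 2 x / 4)], so [u'' = ((c ^ 2 - c) / s ^ 2 + x) u],
   and [v = u' - sqrt x u].  Then [(exp (sqrt x s) v)' = (c ^ 2 - c) s ^ -2 exp (sqrt x s) u];
   since [c > 1], [v / u] is an integral of completely monotone functions with nonnegative
   weight, and it is, up to [c / s], the derivative in [s] of
   [ln (exp (- s sqrt x) B_mu (s ^ 2 x / 4))]. *)

Set Implicit Arguments.
Unset Strict Implicit.
Unset Printing Implicit Defensive.

Import Order.TTheory GRing.Theory Num.Theory.
Import numFieldNormedType.Exports.

Local Open Scope classical_set_scope.
Local Open Scope ring_scope.

(** * Completely monotone functions *)

(** Complete monotonicity of the two factors would only make [chi] a Laplace transform; infinite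
    divisibility needs all its roots, hence the logarithms. For [B_mu] the Sturm-Liouville argument
    alone goes the wrong way: [B_mu] increases, and only the damping [exp (- a sqrt x)] makes the
    factor decrease. The exponent [c] comes from Liouville's normal form: [s ^ c B_mu (s ^ 2 x / 4)]
    is, up to a factor depending on [x] alone, [sqrt s I_mu (s sqrt x)], whose equation has no
    first-order term. As [c ^ 2 - c = mu ^ 2 - 1 / 4], the bound [1 / 2 < mu] is what makes the
    weight positive. The ratios of [B_mu] enter through [u t / u s] inside the integral for [v / u].

    The other obstacle is [K_nu], given by a quotient of series or by a limit in the order, from
    which no positivity can be read. It has to be identified with the integral [M_nu]; the constant
    linking them is [pi / sin (nu pi)], which is why the reflection formula of [Gamma] is proved. *)

Section finite_difference_monotonicity.
Context {R : realType}.
Implicit Types (f g G H : R -> R) (n : nat).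

(* Complete monotonicity up to order [n], phrased with forward differences rather than
   derivatives, which makes it stable under pointwise limits. *)
Fixpoint CMn n f : Prop :=
  (forall x, 0 < x -> 0 <= f x) /\
  if n is m.+1 then forall d, 0 < d -> CMn m (fun x => f x - f (x + d))
  else True.

Lemma CMn_ge0 n f : CMn n f -> forall x, 0 < x -> 0 <= f x.
Proof. by case: n => [|n] []. Qed.

Lemma CMn_ext n f g : (forall x, 0 < x -> f x = g x) -> CMn n f -> CMn n g.
Proof.
elim: n f g => [|n IH] f g fg [f0 fd]; split => //.
- by move=> x x0; rewrite -fg// f0.
- by move=> x x0; rewrite -fg// f0.
- move=> d d0; apply: IH (fd d d0) => x x0.
  by rewrite !fg// addr_gt0.
Qed.

Lemma CMnS n f : CMn n.+1 f -> CMn n f.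
Proof.
by elim: n f => [|n IH] f [f0 fd]; split => // d d0; exact/IH/fd.
Qed.

Lemma CMn_shift n d f : 0 <= d -> CMn n f -> CMn n (fun x => f (x + d)).
Proof.
move=> d0; elim: n f => [|n IH] f [f0 fd]; split => //.
- by move=> x x0; rewrite f0// ltr_wpDr.
- by move=> x x0; rewrite f0// ltr_wpDr.
- move=> e e0; apply: CMn_ext (IH _ (fd e e0)) => x x0 /=.
  by rewrite addrAC.
Qed.

Lemma CMn_cst n c : 0 <= c -> CMn n (fun=> c).
Proof.
elim: n c => [|n IH] c c0; split => // d d0.
by apply: CMn_ext (IH 0 (lexx _)) => x _; rewrite subrr.
Qed.

Lemma CMnD n f g : CMn n f -> CMn n g -> CMn n (fun x => f x + g x).
Proof.
elim: n f g => [|n IH] f g [f0 fd] [g0 gd]; split => //.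
- by move=> x x0; rewrite addr_ge0 ?f0 ?g0.
- by move=> x x0; rewrite addr_ge0 ?f0 ?g0.
- by move=> d d0; apply: CMn_ext (IH _ _ (fd d d0) (gd d d0)) => x x0; ring.
Qed.

(** Discrete Leibniz rule with one factor shifted: [f g - f' g' = (f - f') g + f' (g - g')], where
    primes denote the shift by [d]. *)
Lemma CMnM n f g : CMn n f -> CMn n g -> CMn n (fun x => f x * g x).
Proof.
elim: n f g => [|n IH] f g Cf Cg.
  by split=> // x x0; rewrite mulr_ge0// ?(CMn_ge0 Cf) ?(CMn_ge0 Cg).
split => [x x0|d d0].
  by rewrite mulr_ge0// ?(CMn_ge0 Cf) ?(CMn_ge0 Cg).
have H1 := IH _ _ (Cf.2 d d0) (CMnS Cg).
have H2 := IH _ _ (CMn_shift (ltW d0) (CMnS Cf)) (Cg.2 d d0).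
by apply: CMn_ext (CMnD H1 H2) => x x0; ring.
Qed.

Lemma CMnZ n c f : 0 <= c -> CMn n f -> CMn n (fun x => c * f x).
Proof. by move=> c0 Cf; exact: CMnM (CMn_cst n c0) Cf. Qed.

Lemma CMn_exprn n k f : CMn n f -> CMn n (fun x => f x ^+ k).
Proof.
move=> Cf; elim: k => [|k IH].
  by apply: CMn_ext (CMn_cst n (@ler01 R)) => x _; rewrite expr0.
by apply: CMn_ext (CMnM Cf IH) => x _; rewrite exprS.
Qed.

Lemma CMn_sum n (I : Type) (r : seq I) (f_ : I -> R -> R) :
  (forall i, CMn n (f_ i)) -> CMn n (fun x => \sum_(i <- r) f_ i x).
Proof.
move=> Cf; elim: r => [|i r IH].
  by apply: CMn_ext (CMn_cst n (lexx 0)) => x _; rewrite big_nil.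
by apply: CMn_ext (CMnD (Cf i) IH) => x _; rewrite big_cons.
Qed.

Lemma CMn_cvg n (T : Type) (F : set_system T) (FF : ProperFilter F)
    (f_ : T -> R -> R) f :
  (\forall t \near F, CMn n (f_ t)) ->
  (forall x, 0 < x -> f_ t x @[t --> F] --> f x) -> CMn n f.
Proof.
elim: n f_ f => [|n IH] f_ f Cf fcv; split => //.
- move=> x x0; apply: (cvgr_to_ge (fcv x x0)).
  by near=> t; apply: (@CMn_ge0 0) x0; near: t.
- move=> x x0; apply: (cvgr_to_ge (fcv x x0)).
  by near=> t; apply: (@CMn_ge0 n.+1) x0; near: t.
- move=> d d0; apply: (IH (fun t x => f_ t x - f_ t (x + d))).
    near=> t; have [|_] := (_ : CMn n.+1 (f_ t)); last exact.
    by near: t.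
  by move=> x x0; apply: cvgB; apply: fcv => //; rewrite addr_gt0.
Unshelve. all: by end_near. Qed.

(** Partial sums of the exponential series without its constant term are polynomials in [f] with
    nonnegative coefficients. *)
Lemma CMn_expR_sub1 n f : CMn n f -> CMn n (fun x => expR (f x) - 1).
Proof.
move=> Cf.
apply: (@CMn_cvg n nat \oo _
  (fun N x => \sum_(0 <= k < N) (k.+1`!%:R^-1 * f x ^+ k.+1))).
  apply: nearW => N; apply: CMn_sum => k.
  by apply: CMnZ; [rewrite invr_ge0 ler0n | exact: CMn_exprn].
move=> x x0.
have h : series (exp_coeff (f x)) N.+1 - 1 @[N --> \oo] --> expR (f x) - 1.
  apply: cvgB; last exact: cvg_cst.
  rewrite (cvg_shiftS (series (exp_coeff (f x)))).
  exact: is_cvg_series_exp_coeff.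
apply: cvg_trans h; apply: near_eq_cvg; apply: nearW => N.
rewrite /series /= big_nat_recl// /exp_coeff /= expr0 fact0 divr1 addrAC subrr add0r.
by apply: eq_bigr => i _; rewrite mulrC.
Qed.

(** Induction on [n] through [exp (- H x) - exp (- H (x + d)) = exp (- H (x + d)) (exp (H (x + d) -
    H x) - 1)]. The level gained between hypothesis and conclusion drives the bootstrap in
    [sturm_liouville_ratio]. *)
Lemma CMn_expRN n H :
  (forall d, 0 < d -> CMn n (fun x => H (x + d) - H x)) ->
  CMn n.+1 (fun x => expR (- H x)).
Proof.
elim: n => [|n IH] CH.
  split=> [x _|d d0]; first exact: expR_ge0.
  split=> // x x0; rewrite subr_ge0 ler_expR lerN2 -subr_ge0.
  exact: (CMn_ge0 (CH d d0)).
split=> [x _|d d0]; first exact: expR_ge0.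
have C1 := IH (fun d d0 => CMnS (CH d d0)).
apply: CMn_ext (CMnM (CMn_shift (ltW d0) C1) (CMn_expR_sub1 (CH d d0))) => x x0.
by rewrite mulrBr mulr1 -expRD; congr (expR _ - _); ring.
Qed.

(** [1 / G x - 1 / G (x + d)] is the increment of [G] divided by [G x * G (x + d)], and the
    induction hypothesis covers both inverses; again one level is gained. *)
Lemma CMn_inv n G : (forall x, 0 < x -> 0 < G x) ->
  (forall d, 0 < d -> CMn n (fun x => G (x + d) - G x)) ->
  CMn n.+1 (fun x => (G x)^-1).
Proof.
move=> G0; elim: n => [|n IH] CG.
  split=> [x x0|d d0]; first by rewrite invr_ge0 ltW// G0.
  split=> // x x0; rewrite subr_ge0 lef_pV2 ?posrE ?G0 ?addr_gt0// -subr_ge0.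
  exact: (CMn_ge0 (CG d d0)).
split=> [x x0|d d0]; first by rewrite invr_ge0 ltW// G0.
have C1 := IH (fun d d0 => CMnS (CG d d0)).
have C2 := CMnM C1 (CMn_shift (ltW d0) C1).
apply: CMn_ext (CMnM (CG d d0) C2) => x x0.
have gx : G x != 0 by rewrite gt_eqF ?G0.
have gxd : G (x + d) != 0 by rewrite gt_eqF ?G0// addr_gt0.
by field; rewrite gx gxd.
Qed.

(** Rationalizing gives [d / (sqrt (x + d) + sqrt x)], and the increments of this denominator are
    sums of two expressions of the same kind, one level lower. *)
Lemma CMn_sqrt n d : 0 < d ->
  CMn n (fun x : R => Num.sqrt (x + d) - Num.sqrt x).
Proof.
elim: n d => [|n IH] d d0.
  by split=> // x x0; rewrite subr_ge0 ler_wsqrtr// lerDl ltW.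
have : CMn n.+1 (fun x : R => (Num.sqrt (x + d) + Num.sqrt x)^-1).
  apply: CMn_inv => [x x0|e e0].
    by rewrite ltr_wpDr ?sqrtr_ge0// sqrtr_gt0 addr_gt0.
  apply: CMn_ext (CMnD (CMn_shift (ltW d0) (IH e e0)) (IH e e0)) => x x0.
  by rewrite /= (addrAC x e d); ring.
move/(CMnZ (ltW d0)); apply: CMn_ext => x x0.
have s0 : Num.sqrt (x + d) + Num.sqrt x != 0.
  by rewrite gt_eqF// ltr_wpDr ?sqrtr_ge0// sqrtr_gt0 addr_gt0.
apply: (mulIf s0); rewrite divfK//.
transitivity (Num.sqrt (x + d) ^+ 2 - Num.sqrt x ^+ 2); last by ring.
by rewrite !sqr_sqrtr ?ltW ?addr_gt0//; ring.
Qed.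

(** [G b - G a] is the integral of [g] over [[a, b]], but no integral is formed: differences in [x]
    commute with the derivative in [t], so the induction comes down to the monotonicity of a
    function with nonnegative derivative. *)
Lemma CMn_increment n (G g : R -> R -> R) (a b : R) : a <= b ->
  (forall t x, a <= t <= b -> 0 < x ->
    is_derive t 1 (fun s => G s x) (g t x)) ->
  (forall t, a <= t <= b -> CMn n (g t)) ->
  CMn n (fun x => G b x - G a x).
Proof.
move=> ab; elim: n G g => [|n IH] G g dG Cg.
  split=> // x x0; rewrite subr_ge0.
  have dGx t : t \in `[a, b] -> is_derive t 1 (G ^~ x) (g t x).
    by rewrite in_itv/= => tab; exact: dG.
  apply: (@ger0_derive1_ndecr _ (G ^~ x) a b) => //.
  - by move=> t /subset_itv_oo_cc /dGx [].
  - move=> t /subset_itv_oo_cc tab; rewrite derive1E.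
    have [_ ->] := dGx t tab; apply: CMn_ge0 (Cg t _) _ x0.
    by move: tab; rewrite in_itv.
  - apply: derivable_within_continuous => t tab.
    by have [] := dGx t tab.
split=> [x x0|d d0].
  exact: (CMn_ge0 (IH _ _ dG (fun t tab => CMnS (Cg t tab)))).
apply: (@CMn_ext _ (fun x => (G b x - G b (x + d)) - (G a x - G a (x + d)))).
  by move=> x x0; ring.
apply: (IH (fun t x => G t x - G t (x + d)) (fun t x => g t x - g t (x + d))).
  move=> t x tab x0.
  by apply: is_deriveB; apply: dG => //; rewrite addr_gt0.
by move=> t tab; have [_] := Cg t tab; exact.
Qed.

End finite_difference_monotonicity.

(** * First-order systems and their Wronskians *)

Section sturm_liouville.
Context {R : realType}.
Variables (P Q : R -> R) (f E : R -> R -> R).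
Hypotheses (P_ge0 : forall t, 0 <= P t) (Q_ge0 : forall t, 0 <= Q t).
Hypothesis f_gt0 : forall t x : R, 0 < x -> 0 < f t x.
Hypothesis f_derive : forall t x : R, 0 < x ->
  is_derive t 1 (f ^~ x) (P t * E t x).
Hypothesis E_derive : forall t x : R, 0 < x ->
  is_derive t 1 (E ^~ x) (x * Q t * f t x).
Hypothesis Ef_cvg0 : forall x y : R, 0 < x -> 0 < y ->
  E t x * f t y @[t --> -oo] --> 0.

Let logderiv_of_ratio n : (forall a b, a <= b -> CMn n (fun x => f a x / f b x)) ->
  forall b d, 0 < d ->
    CMn n (fun x => E b (x + d) / f b (x + d) - E b x / f b x).
Proof.
move=> Cf b d d0.
(* The normalized Wronskian of [f ^~ x] and [f ^~ (x + d)], with [t]-derivative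
   [d * Q t * (f t x / f b x) * (f t (x + d) / f b (x + d))]. *)
pose W t x := (f b x)^-1 * (f b (x + d))^-1 *
  (E t (x + d) * f t x - E t x * f t (x + d)).
have CW a : a <= b -> CMn n (fun x => W b x - W a x).
  pose w t x := d * Q t * ((f t x / f b x) * (f t (x + d) / f b (x + d))).
  move=> ab; apply: (@CMn_increment R n W w a b ab).
    move=> t x _ x0; have xd0 : 0 < x + d by rewrite addr_gt0.
    pose df := f_derive t x0; pose df' := f_derive t xd0.
    pose dE := E_derive t x0; pose dE' := E_derive t xd0.
    apply: is_derive_eq; rewrite /w /GRing.scale/=; ring.
  move=> t /andP[_ tb]; apply: CMnZ; first by rewrite mulr_ge0// ltW.
  by apply: CMnM; [|apply: (CMn_shift (f := fun x => f t x / f b x) (ltW d0))]; exact: Cf.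
apply: (@CMn_ext _ _ (W b)).
  move=> x x0; rewrite /W; field.
  by rewrite !gt_eqF ?f_gt0 ?addr_gt0.
(* Letting [a] tend to [-oo] removes [W a], which vanishes in the limit by [Ef_cvg0]. *)
apply: (@CMn_cvg _ n _ -oo%R _ (fun a x => W b x - W a x)).
  near=> a; apply: CW; near: a; exact: nbhs_ninfty_le (num_real b).
move=> x x0; have xd0 : 0 < x + d by rewrite addr_gt0.
rewrite -[X in _ --> X]subr0; apply: cvgB; first exact: cvg_cst.
rewrite -[X in _ --> X](mulr0 ((f b x)^-1 * (f b (x + d))^-1)).
apply: cvgMr.
rewrite -[X in _ --> X]subr0.
by apply: cvgB; exact: Ef_cvg0.
Unshelve. all: by end_near. Qed.

(** The derivative of [ln f] in [t] is [P * E / f], whose increments in [x] are controlled by the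
    hypothesis. *)
Let log_increment n :
  (forall b d, 0 < d -> CMn n (fun x => E b (x + d) / f b (x + d) - E b x / f b x)) ->
  forall a b d, a <= b -> 0 < d ->
    CMn n (fun x => (ln (f b (x + d)) - ln (f b x)) -
                    (ln (f a (x + d)) - ln (f a x))).
Proof.
move=> CE a b d ab d0.
apply: (@CMn_increment _ _ (fun t x => ln (f t (x + d)) - ln (f t x))
  (fun t x => P t * (E t (x + d) / f t (x + d) - E t x / f t x))) => //.
  move=> t x _ x0; have xd0 : 0 < x + d by rewrite addr_gt0.
  pose df := f_derive t x0; pose df' := f_derive t xd0.
  pose dl := is_derive1_ln (f_gt0 t x0).
  pose dl' := is_derive1_ln (f_gt0 t xd0).
  apply: is_derive_eq; rewrite /GRing.scale/=; ring.
by move=> t _; apply: CMnZ => //; exact: CE.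
Qed.

(* The ratios at level [n] control the logarithmic derivatives [E / f] at the same level, and
   these control [ln (f b / f a)] at level [n], hence the ratios at level [n + 1]. *)
Lemma sturm_liouville_ratio n a b : a <= b -> CMn n (fun x => f a x / f b x).
Proof.
elim: n a b => [|n IH] a b ab.
  by split=> // x x0; rewrite divr_ge0// ltW// f_gt0.
apply: (@CMn_ext _ _ (fun x => expR (- (ln (f b x) - ln (f a x))))).
  by move=> x x0; rewrite opprB expRB !lnK ?posrE ?f_gt0.
apply: CMn_expRN => d d0.
by apply: CMn_ext (log_increment (logderiv_of_ratio IH) ab d0) => x _; ring.
Qed.

Lemma sturm_liouville_ln n a b d : a <= b -> 0 < d ->
  CMn n (fun x => (ln (f b (x + d)) - ln (f b x)) -
                  (ln (f a (x + d)) - ln (f a x))).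
Proof. by apply: log_increment; apply: logderiv_of_ratio; exact: sturm_liouville_ratio. Qed.

End sturm_liouville.

(** * Bernstein's theorem *)

Section monotone_integral.
Context {R : realType}.
Notation mu := (@lebesgue_measure R).
Implicit Type phi : R -> R.

Lemma nondecreasing_integrable phi (a b : R) : nondecreasing_fun phi ->
  mu.-integrable `]a, b] (EFin \o phi).
Proof.
move=> ndphi; apply: measurable_bounded_integrable => //.
- have /= -> := lebesgue_measure_itv `]a, b].
  by case: ifPn => // _; rewrite -EFinB ltry.
- exact: nondecreasing_measurable.
- exists (`|phi a| + `|phi b|); split; first exact: num_real.
  move=> M Mab x /=; rewrite in_itv/= => /andP[ax xb].
  apply: (le_trans _ (ltW Mab)); rewrite ler_norml; apply/andP; split.
    rewrite (le_trans _ (ndphi _ _ (ltW ax)))// opprD.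
    by rewrite (le_trans _ (lerNnormlW (lexx _)))// lerBlDr lerDl.
  by rewrite (le_trans (ndphi _ _ xb))// (le_trans (ler_norm _))// lerDr.
Qed.

Lemma nondecreasing_Rintegral_split phi (a b c : R) : nondecreasing_fun phi ->
  a <= b -> b <= c ->
  \int[mu]_(x in `]a, c]) phi x =
  \int[mu]_(x in `]a, b]) phi x + \int[mu]_(x in `]b, c]) phi x.
Proof.
move=> ndphi ab bc; apply/eqP; rewrite addrC -subr_eq; apply/eqP.
by apply: Rintegral_itvB; [exact: nondecreasing_integrable|rewrite bnd_simp..].
Qed.

Lemma Rintegral_const_itv phi (a b c : R) : a <= b ->
  (forall x, a < x <= b -> phi x = c) ->
  \int[mu]_(x in `]a, b]) phi x = c * (b - a).
Proof.
move=> ab phic; rewrite (@eq_Rintegral _ _ _ _ _ (fun=> c)); last first.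
  by move=> x; rewrite inE/= in_itv/= => /phic.
rewrite Rintegral_cst//; congr (_ * _).
have /= -> := lebesgue_measure_itv `]a, b].
rewrite lte_fin; move: ab; rewrite le_eqVlt => /predU1P[->|->].
  by rewrite ltxx subrr.
by rewrite -EFinB.
Qed.

Lemma nondecreasing_Rintegral_le phi (a b : R) : nondecreasing_fun phi ->
  a <= b -> \int[mu]_(x in `]a, b]) phi x <= phi b * (b - a).
Proof.
move=> ndphi ab; rewrite -(@Rintegral_const_itv (fun=> phi b) a b)//.
apply: le_Rintegral => //; [exact: nondecreasing_integrable|..].
  by apply: (@nondecreasing_integrable (fun=> phi b)) => x y _.
by move=> x; rewrite /= in_itv/= => /andP[_ xb]; exact: ndphi.
Qed.

Lemma nondecreasing_Rintegral_ge phi (a b : R) : nondecreasing_fun phi ->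
  a <= b -> phi a * (b - a) <= \int[mu]_(x in `]a, b]) phi x.
Proof.
move=> ndphi ab; rewrite -(@Rintegral_const_itv (fun=> phi a) a b)//.
apply: le_Rintegral => //; [|exact: nondecreasing_integrable|].
  by apply: (@nondecreasing_integrable (fun=> phi a)) => x y _.
by move=> x; rewrite /= in_itv/= => /andP[ax _]; exact/ndphi/ltW.
Qed.

(** The left and right sums bracket the integral and their difference telescopes. The bound involves
    only the end values, so it is uniform over a bounded family of monotone functions; this replaces
    a convergence theorem along an ultrafilter. *)
Lemma nondecreasing_riemann_sum phi (N : nat) : nondecreasing_fun phi ->
  `| \int[mu]_(x in `]0, 1]) phi x
     - N.+1%:R^-1 * \sum_(0 <= i < N.+1) phi (i.+1%:R / N.+1%:R) |
  <= N.+1%:R^-1 * (phi 1 - phi 0).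
Proof.
move=> ndphi; set h : R := N.+1%:R^-1.
have h0 : 0 <= h by rewrite invr_ge0 ler0n.
have main k : h * \sum_(0 <= i < k) phi (i%:R * h) <=
    \int[mu]_(x in `]0, k%:R * h]) phi x <=
    h * \sum_(0 <= i < k) phi (i.+1%:R * h).
  elim: k => [|k /andP[IH1 IH2]].
    by rewrite !big_nil mul0r mulr0 set_itv_ge ?bnd_simp ?ltxx// Rintegral_set0 lexx.
  have kh : 0 <= k%:R * h by rewrite mulr_ge0.
  have kkh : k%:R * h <= k.+1%:R * h by rewrite ler_wpM2r// ler_nat.
  have hE : k.+1%:R * h - k%:R * h = h by rewrite -mulrBl -natrB// subSnn mul1r.
  rewrite (nondecreasing_Rintegral_split ndphi kh kkh) !big_nat_recr//= !mulrDr.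
  apply/andP; split; apply: lerD => //.
    by have := nondecreasing_Rintegral_ge ndphi kkh; rewrite hE [leLHS]mulrC.
  by have := nondecreasing_Rintegral_le ndphi kkh; rewrite hE [leRHS]mulrC.
have Nh : N.+1%:R * h = 1 by rewrite divff ?pnatr_eq0.
have := main N.+1; rewrite Nh => /andP[lb ub].
rewrite ler_norml; apply/andP; split; last first.
  by apply: (@le_trans _ _ 0); rewrite ?subr_le0// mulr_ge0// subr_ge0 ndphi.
rewrite lerNl opprB.
rewrite (le_trans (lerB (lexx _) lb))// -mulrBr ler_wpM2l// -sumrB.
rewrite (telescope_sumr (fun i => phi (i%:R * h)))//.
by rewrite mul0r Nh.
Qed.

End monotone_integral.

(** * Quantile function of finitely many weights *)

Section quantile.
Context {R : realType}.
Notation mu := (@lebesgue_measure R).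
Variables (n : nat) (w : nat -> R).
Hypothesis w_ge0 : forall i, 0 <= w i.

Definition cumul k : R := \sum_(0 <= i < k) w i.

(** The left-continuous inverse of the cumulated weights, written as a count: monotonicity in [u]
    and the bound by [n] are then immediate. *)
Definition quantile (u : R) : nat := (\sum_(0 <= i < n) (cumul i.+1 < u)%R)%N.

Lemma cumul_le i j : (i <= j)%N -> cumul i <= cumul j.
Proof.
move=> ij; rewrite /cumul (big_cat_nat (n := i) (p := j))//= lerDl.
by apply: sumr_ge0 => k _.
Qed.

Lemma quantile_le u v : u <= v -> (quantile u <= quantile v)%N.
Proof.
move=> uv; apply: leq_sum => i _.
by case: (ltP (cumul i.+1) u) => // iu; rewrite (lt_le_trans iu uv).
Qed.

Lemma quantile_le_size u : (quantile u <= n)%N.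
Proof.
rewrite /quantile -[leqRHS]subn0 -[leqRHS]muln1 -sum_nat_const_nat.
by apply: leq_sum => i _; case: (_ < _).
Qed.

Lemma quantileE k u : (k <= n)%N -> cumul k < u <= cumul k.+1 -> quantile u = k.
Proof.
move=> kn /andP[ku uk]; rewrite /quantile (big_cat_nat (n := k))//=.
rewrite (@eq_big_nat _ _ _ 0%N k _ (fun=> 1%N)); last first.
  by move=> i /andP[_ ik]; rewrite (le_lt_trans _ ku)// cumul_le.
rewrite (@eq_big_nat _ _ _ k n _ (fun=> 0%N)); last first.
  move=> i /andP[ki _]; apply/eqP; rewrite eqb0 -leNgt.
  by rewrite (le_trans uk)// cumul_le.
by rewrite sum_nat_const_nat big1// muln1 subn0 addn0.
Qed.

(** On []cumul k, cumul k.+1]], an interval of length [w k], the quantile is constantly [k].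
    Monotonicity of [g] provides the integrability needed to split the integral. *)
Lemma Rintegral_quantile (g : nat -> R) k : (k <= n.+1)%N ->
  {homo g : i j / (i <= j)%N >-> i <= j} ->
  \int[mu]_(u in `]0, cumul k]) g (quantile u) = \sum_(0 <= i < k) g i * w i.
Proof.
move=> + gle; elim: k => [_|k IH kn].
  by rewrite /cumul !big_nil set_itv_ge ?bnd_simp ?ltxx// Rintegral_set0.
rewrite (@nondecreasing_Rintegral_split _ (g \o quantile) _ (cumul k)).
- rewrite (IH (ltnW kn)) big_nat_recr//=; congr (_ + _).
  rewrite (@Rintegral_const_itv _ _ _ _ (g k)); first last.
  + by move=> x /quantileE ->.
  + exact: cumul_le.
  by rewrite /cumul big_nat_recr//= addrAC subrr add0r.
- by move=> u v uv; exact/gle/quantile_le.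
- by apply: sumr_ge0.
- exact: cumul_le.
Qed.

End quantile.

(** * Hausdorff moment problem for finitely many samples *)

Section hausdorff.
Context {R : realType}.
Implicit Types (a : nat -> R) (f : R -> R).

Definition ndiff m a : nat -> R := iter m (fun b k => b k - b k.+1) a.

(** Differences of samples are samples of a difference of [f]. Sampling starts at [h] because [CMn]
    says nothing at [0]. *)
Lemma ndiff_sample_ge0 m f (h : R) k : 0 < h -> CMn m f ->
  0 <= ndiff m (fun j => f (j.+1%:R * h)) k.
Proof.
move=> h0; elim: m f k => [|m IH] f k Cf.
  by apply: (CMn_ge0 Cf); rewrite mulr_gt0.
have -> : ndiff m.+1 (fun j => f (j.+1%:R * h)) =
    ndiff m (fun j => f (j.+1%:R * h) - f (j.+1%:R * h + h)).
  rewrite /ndiff iterSr; congr (iter m _ _); apply/funext => j.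
  by congr (_ - f _); rewrite -[in LHS]natr1 mulrDl mul1r.
exact: (IH (fun x => f x - f (x + h))) (Cf.2 h h0).
Qed.

(** The identity is the difference operator plus the shift, since [a k = (a k - a k.+1) + a k.+1];
    this is the binomial expansion of its [m]-th power. *)
Lemma ndiff_binomial_sum a m j :
  \sum_(0 <= i < m.+1) 'C(m, i)%:R * ndiff (m - i) a (i + j)%N = a j.
Proof.
elim: m => [|m IH]; first by rewrite big_nat1 mul1r.
rewrite -[RHS]IH.
have -> : \sum_(0 <= i < m.+2) 'C(m.+1, i)%:R * ndiff (m.+1 - i) a (i + j)%N =
  \sum_(0 <= i < m.+2) 'C(m, i)%:R * ndiff (m.+1 - i) a (i + j)%N +
  \sum_(0 <= i < m.+1) 'C(m, i)%:R * ndiff (m - i) a (i.+1 + j)%N.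
  rewrite [in LHS]big_nat_recl// [X in _ = X + _]big_nat_recl//= -addrA !bin0.
  congr (_ + _); rewrite -big_split/=; apply: eq_bigr => i _.
  by rewrite binS natrD mulrDl subSS.
rewrite [X in X + _]big_nat_recr//= bin_small// mul0r addr0 -big_split/=.
apply: eq_big_nat => i /andP[_ im]; rewrite -mulrDr subSn//=.
by rewrite addSn subrK.
Qed.

Lemma bin_ffact_mul n k j : (j <= k)%N -> (k <= n)%N ->
  ('C(n, k) * k ^_ j = n ^_ j * 'C(n - j, k - j))%N.
Proof.
move=> jk kn; have jn := leq_trans jk kn.
apply/eqP; rewrite -(@eqn_pmul2r ((k - j)`! * (n - k)`!)) ?muln_gt0 ?fact_gt0//.
apply/eqP; rewrite mulnA -(mulnA 'C(n, k)) ffact_fact// -mulnA bin_fact//.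
have := bin_fact (leq_sub2r j kn); rewrite subnBA// subnK// => e.
by rewrite -mulnA e ffact_fact.
Qed.

(* Bernstein weights of the Hausdorff moment problem: when [a] samples the function at
   [j.+1%:R * h], the weight [k] approximates the mass at [t] with [expR (- (h * t)) = k / n]. *)
Definition hausdorff_weight a n k : R := 'C(n, k)%:R * ndiff (n - k) a k.

(** [bin_ffact_mul] turns the sum into [ndiff_binomial_sum] for [n - j]. Falling factorials are the
    moments that the weights reproduce without error; powers follow only up to [O(1 / n)]. *)
Lemma hausdorff_factorial_moment a n j : (j <= n)%N ->
  \sum_(0 <= k < n.+1) hausdorff_weight a n k * (k ^_ j)%:R = (n ^_ j)%:R * a j.
Proof.
move=> jn; rewrite (big_cat_nat (n := j))//=; last by rewrite ltnW.
rewrite big_nat_cond big1 ?add0r; last first.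
  by move=> i /andP[/andP[_ ij] _]; rewrite ffact_small// mulr0.
rewrite -(ndiff_binomial_sum a (n - j) j) big_distrr/=.
rewrite -{1}(add0n j) big_addn subSn//; apply: eq_big_nat => i /andP[_ ij].
rewrite /hausdorff_weight mulrAC -natrM bin_ffact_mul ?leq_addl//; last first.
  by rewrite addnC -leq_subRL.
by rewrite addnK natrM -mulrA subnDA subnAC.
Qed.

(** Passing from [j] to [j.+1] multiplies one side by [k / n] and the other by [(k - j) / (n - j)].
    Where it matters these differ by at most [j / n], and [j ^ 2 + j <= (j + 1) ^ 2]. *)
Lemma ffact_ratio_approx n k j : (k <= n)%N -> (j <= n)%N -> (0 < n)%N ->
  `| (k%:R / n%:R) ^+ j - (k ^_ j)%:R / (n ^_ j)%:R | <= j%:R ^+ 2 / n%:R :> R.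
Proof.
move=> kn + n0; have n0R : (0 : R) < n%:R by rewrite ltr0n.
set x : R := k%:R / n%:R.
have x0 : 0 <= x by rewrite divr_ge0.
have x1 : x <= 1 by rewrite ler_pdivrMr// mul1r ler_nat.
elim: j => [|j IH] jn.
  by rewrite expr0 !ffactn0 divr1 subrr normr0 expr0n/= mul0r.
have {}IH := IH (ltnW jn).
have n0' : (0 : R) < (n ^_ j)%:R by rewrite ltr0n ffact_gt0 ltnW.
set e : R := (k ^_ j)%:R / (n ^_ j)%:R in IH *.
have nj0 : (0 : R) < (n - j)%:R by rewrite ltr0n subn_gt0.
have -> : (k ^_ j.+1)%:R / (n ^_ j.+1)%:R = e * ((k - j)%:R / (n - j)%:R) :> R.
  rewrite !ffactnSr !natrM /e; field.
  by rewrite !gt_eqF.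
have step : `|e * (x - (k - j)%:R / (n - j)%:R)| <= j%:R / n%:R.
  (* For [k < j] the subtraction [k - j] is truncated, but the falling factorial in [e] already
     vanishes. *)
  case: (ltnP k j) => kj.
    by rewrite /e ffact_small// !mul0r normr0 divr_ge0.
  have e0 : 0 <= e by rewrite divr_ge0.
  have e1 : e <= 1.
    rewrite ler_pdivrMr// mul1r ler_nat.
    have : ('C(k, j) * j`! <= 'C(n, j) * j`!)%N by rewrite leq_mul2r leq_bin2l// orbT.
    by rewrite !bin_ffact.
  rewrite normrM (ger0_norm e0) -[leRHS]mul1r ler_pM//.
  have -> : x - (k - j)%:R / (n - j)%:R =
      j%:R / n%:R * ((n%:R - k%:R) / (n%:R - j%:R)).
    rewrite /x !natrB//; last exact: ltnW.
    have nn : n%:R != 0 :> R by rewrite gt_eqF.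
    have nj : n%:R - j%:R != 0 :> R by rewrite -natrB ?gt_eqF// ltnW.
    by field; rewrite ?nn ?nj.
  have c0 : 0 <= (n%:R - k%:R) / (n%:R - j%:R) :> R.
    by rewrite divr_ge0// subr_ge0 ler_nat// ltnW.
  rewrite ger0_norm; last by rewrite mulr_ge0// divr_ge0.
  have nj : 0 < n%:R - j%:R :> R by rewrite -natrB// ltnW.
  rewrite ler_piMr ?divr_ge0// ler_pdivrMr// mul1r.
  by rewrite lerD2l lerN2 ler_nat.
have -> : x ^+ j.+1 - e * ((k - j)%:R / (n - j)%:R) =
  x * (x ^+ j - e) + e * (x - (k - j)%:R / (n - j)%:R) by rewrite exprS; ring.
rewrite (le_trans (ler_normD _ _))// (le_trans (lerD (lexx _) step))//.
rewrite normrM (ger0_norm x0).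
rewrite (@le_trans _ _ (j%:R ^+ 2 / n%:R + j%:R / n%:R))// ?lerD2r.
  by rewrite (le_trans (ler_piMl _ x1)).
rewrite -mulrDl ler_pM2r ?invr_gt0// -natr1.
have : (0 : R) <= j%:R by []. nra.
Qed.

End hausdorff.

Section hausdorff_powers.
Context {R : realType}.
Variables (a : nat -> R) (n : nat).
Hypotheses (n_gt0 : (0 < n)%N) (a0_le1 : a 0%N <= 1).
Hypothesis w_ge0 : forall k, 0 <= hausdorff_weight a n k.
Let w := hausdorff_weight a n.

Lemma hausdorff_weight_sum : \sum_(0 <= k < n.+1) w k = a 0%N.
Proof.
have := hausdorff_factorial_moment a (leq0n n).
rewrite ffactn0 mul1r => <-; apply: eq_bigr => k _.
by rewrite ffactn0 mulr1.
Qed.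

Lemma hausdorff_power_moment i : (i <= n)%N ->
  `| \sum_(0 <= k < n.+1) (k%:R / n%:R) ^+ i * w k - a i | <= i%:R ^+ 2 / n%:R.
Proof.
move=> i_n; have nf0 : (n ^_ i)%:R != 0 :> R.
  by rewrite pnatr_eq0 -lt0n ffact_gt0.
have -> : a i = \sum_(0 <= k < n.+1) (k ^_ i)%:R / (n ^_ i)%:R * w k.
  apply: (mulfI nf0); rewrite -hausdorff_factorial_moment// mulr_sumr.
  by apply: eq_bigr => k _; rewrite /w; field.
rewrite -sumrB (le_trans (ler_norm_sum _ _ _))//.
rewrite (@le_trans _ _ (\sum_(0 <= k < n.+1) i%:R ^+ 2 / n%:R * w k))//.
  rewrite big_nat [leRHS]big_nat; apply: ler_sum => k /andP[_ kn].
  rewrite -mulrBl normrM (ger0_norm (w_ge0 k)) ler_wpM2r ?w_ge0//.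
  exact: ffact_ratio_approx.
by rewrite -mulr_sumr hausdorff_weight_sum ler_piMr// divr_ge0.
Qed.

(** All [k / n] lie in [[0, 1]], so the real power [s] is caught between the integer powers [j.+1]
    and [j]. *)
Lemma hausdorff_powR_moment (s : R) j : 0 < s -> (j < n)%N ->
  j%:R <= s <= j.+1%:R ->
  a j.+1 - j.+1%:R ^+ 2 / n%:R <=
  \sum_(0 <= k < n.+1) (k%:R / n%:R) `^ s * w k <= a j + j%:R ^+ 2 / n%:R.
Proof.
move=> s0 jn /andP[js sj].
have n0 : (0 : R) < n%:R by rewrite ltr0n.
have pow k : (k <= n)%N -> (k%:R / n%:R) ^+ j.+1 <= (k%:R / n%:R : R) `^ s <= (k%:R / n%:R) ^+ j.
  case: k => [_|k kn].
    by rewrite mul0r powR0 ?gt_eqF// exprn_ge0// expr0n/= lexx.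
  have r01 : 0 < (k.+1%:R / n%:R : R) <= 1.
    by rewrite divr_gt0// ler_pdivrMr// mul1r ler_nat.
  have r0 : 0 <= k.+1%:R / n%:R :> R by rewrite divr_ge0.
  by rewrite -!powR_mulrn//; apply/andP; split; apply: ger_powR.
have := hausdorff_power_moment (ltnW jn); rewrite ler_norml => /andP[_ ub].
have := hausdorff_power_moment jn; rewrite ler_norml => /andP[lb _].
have lbS : \sum_(0 <= k < n.+1) (k%:R / n%:R) ^+ j.+1 * w k <=
    \sum_(0 <= k < n.+1) (k%:R / n%:R) `^ s * w k.
  rewrite big_nat [leRHS]big_nat; apply: ler_sum => k /andP[_ kn].
  by rewrite ler_wpM2r ?w_ge0//; have /andP[] := pow k kn.
have ubS : \sum_(0 <= k < n.+1) (k%:R / n%:R) `^ s * w k <=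
    \sum_(0 <= k < n.+1) (k%:R / n%:R) ^+ j * w k.
  rewrite big_nat [leRHS]big_nat; apply: ler_sum => k /andP[_ kn].
  by rewrite ler_wpM2r ?w_ge0//; have /andP[] := pow k kn.
by apply/andP; split; lra.
Qed.

End hausdorff_powers.

Section ultrafilter_limits.
Context {R : realType}.

(** By compactness the image filter has a cluster point, and an ultrafilter converges to each of its
    cluster points. *)
Lemma ultra_cvg_unit (T : Type) (U : set_system T) (UU : UltraFilter U)
    (v : T -> R) : (forall t, 0 <= v t <= 1) -> exists l : R, v t @[t --> U] --> l.
Proof.
move=> v01.
have [|l [l01 lU]] := @segment_compact R 0 1 (fmap v U) _.
  by apply: (@filterS _ U _ setT) filterT => t _ /=; rewrite in_itv/= v01.
exists l => A lA.
have [//|nA] := in_ultra_setVsetC (v @^-1` A) UU.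
by have [r []] := lU (~` A) A nA lA.
Qed.

Lemma cvg_powR_nneg (T : Type) (F : set_system T) (FF : ProperFilter F)
    (v : T -> R) (l x : R) : 0 < x -> (forall t, 0 <= v t) ->
  v t @[t --> F] --> l -> v t `^ x @[t --> F] --> l `^ x.
Proof.
move=> x0 v0 vl.
have : 0 <= l by apply: (cvgr_to_ge vl); exact: nearW.
(* The power need not be differentiable at [l = 0], where the tolerance [e ^ (1 / x)] on [v] is used
   instead. *)
rewrite le_eqVlt => /predU1P[l0|l0].
  rewrite -l0 powR0 ?gt_eqF//; move: vl; rewrite -l0 => vl.
  apply/cvgr0Pnorm_le => e e0.
  have e1 : 0 < e `^ x^-1 by rewrite powR_gt0.
  move/cvgr0Pnorm_le : vl => /(_ _ e1); apply: filterS => t.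
  rewrite !ger0_norm ?powR_ge0// => vt.
  have -> : e = (e `^ x^-1) `^ x by rewrite -powRrM mulVf ?gt_eqF// powRr1// ltW.
  by apply: (ge0_ler_powR (ltW x0)); rewrite ?nnegrE ?v0 ?powR_ge0.
apply: (@continuous_cvg _ _ _ F _ v (fun y => y `^ x) l _ vl).
apply: differentiable_continuous; apply/derivable1_diffP.
by have [] := is_derive1_powR x l0.
Qed.

End ultrafilter_limits.

(** * From discrete weights to a probability measure *)

Section bernstein.
Context {R : realType}.
Notation mu := (@lebesgue_measure R).
Variable f : R -> R.
Hypotheses (f_CM : forall n, CMn n f) (f_le1 : forall x : R, 0 < x -> f x <= 1).
Hypothesis f_cont : forall x : R, 0 < x -> {for x, continuous f}.
Hypothesis f_cvg1 : f x @[x --> 0^'+] --> (1 : R).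

(* [locked] keeps simplification from unfolding this unary number. *)
Let size N : nat := locked (N.+1 ^ 3)%N.
Let step N : R := N.+1%:R^-1.
Let sample N : nat -> R := fun j => f (j.+1%:R * step N).

(* The missing mass [1 - f (step N)] is put at [0]. *)
Let mass N k : R :=
  hausdorff_weight (sample N) (size N) k + (k == 0%N)%:R * (1 - f (step N)).
(** The value of [expR (- t)] when [expR (- (step N * t)) = k / size N]. Thus [level N] is the
    quantile function of [expR (- T)] for [T] with the discretized law, and its power [x] stands for
    [expR (- (x * T))]. *)
Let point N k : R := (k%:R / (size N)%:R) ^+ N.+1.
Let level N (u : R) : R := point N (quantile (size N) (mass N) u).

Let size_gt0 N : (0 < size N)%N. Proof. by rewrite /size -lock expn_gt0. Qed.

Let step_gt0 N : 0 < step N. Proof. by rewrite invr_gt0. Qed.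

Let weight_ge0 N k : 0 <= hausdorff_weight (sample N) (size N) k.
Proof. by rewrite mulr_ge0// ndiff_sample_ge0. Qed.

Let mass_ge0 N k : 0 <= mass N k.
Proof. by rewrite addr_ge0// mulr_ge0// subr_ge0 f_le1. Qed.

Let sample0 N : sample N 0%N = f (step N).
Proof. by rewrite /sample mul1r. Qed.

Let cumul_mass N : cumul (mass N) (size N).+1 = 1.
Proof.
rewrite /cumul big_split hausdorff_weight_sum// sample0.
suff -> m (c : R) : \sum_(0 <= k < m.+1) (k == 0%N)%:R * c = c by rewrite /= addrC subrK.
by rewrite big_nat_recl//= mul1r big1 ?addr0// => i _; rewrite mul0r.
Qed.

Let point_le N : {homo point N : i j / (i <= j)%N >-> i <= j}.
Proof.
move=> i j ij; apply: lerXn2r; rewrite ?nnegrE ?divr_ge0//.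
by rewrite ler_wpM2r// ?invr_ge0// ler_nat.
Qed.

Let point_ge0 N k : 0 <= point N k.
Proof. by rewrite exprn_ge0// divr_ge0. Qed.

Let level_ge0 N u : 0 <= level N u. Proof. exact: point_ge0. Qed.

Let level_le1 N u : level N u <= 1.
Proof.
rewrite exprn_ile1 ?divr_ge0//.
by rewrite ler_pdivrMr ?ltr0n// mul1r ler_nat quantile_le_size.
Qed.

Let level_le N : nondecreasing_fun (level N).
Proof. by move=> u v uv; exact/point_le/quantile_le. Qed.

Let powR_level_le N x : 0 < x -> nondecreasing_fun (fun u => level N u `^ x).
Proof.
by move=> x0 u v uv; apply: (ge0_ler_powR (ltW x0)); rewrite ?nnegrE// level_le.
Qed.

Let Rintegral_level N x : 0 < x ->
  \int[mu]_(u in `]0, 1]) (level N u `^ x) =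
  \sum_(0 <= k < (size N).+1)
    (k%:R / (size N)%:R) `^ (N.+1%:R * x) * hausdorff_weight (sample N) (size N) k.
Proof.
move=> x0.
have := Rintegral_quantile (mass_ge0 N) (g := fun k => point N k `^ x)
  (leqnn (size N).+1).
rewrite cumul_mass => ->; last first.
  by move=> i j ij; apply: (ge0_ler_powR (ltW x0)); rewrite ?nnegrE// point_le.
apply: eq_bigr => k _.
rewrite /point -powR_mulrn ?divr_ge0// -powRrM /mass mulrDr.
(* Index [0] carries the missing mass, but its point is [0], whose positive powers vanish. *)
case: k => [|k]; last by rewrite (mul0r (1 - f (step N))) mulr0 addr0.
rewrite mul0r powR0 ?mul0r ?addr0//.
by rewrite gt_eqF// mulr_gt0.
Qed.

Let f_le x y : 0 < x -> x <= y -> f y <= f x.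
Proof.
move=> x0; rewrite le_eqVlt => /predU1P[->//|xy].
have yx0 : 0 < y - x by rewrite subr_gt0.
have [_ /(_ _ yx0) /(@CMn_ge0 _ 0) /(_ x x0)] := f_CM 1.
by rewrite subr_ge0 addrC subrK.
Qed.

(** With [j] the integer part of [N.+1 * x], the two sampling points [j.+1 * step N] and
    [j.+2 * step N] lie between [x] and [x + 2 * step N], and [f] is nonincreasing. *)
Let Rintegral_level_bounds N x : 0 < x -> x + 1 <= N.+1%:R ->
  f (x + 2 * step N) - (x + 1) ^+ 2 * step N <=
  \int[mu]_(u in `]0, 1]) (level N u `^ x) <=
  f x + (x + 1) ^+ 2 * step N.
Proof.
move=> x0 xN; rewrite Rintegral_level//.
have N0 : (0 : R) < N.+1%:R by [].
have N1 : 1 <= N.+1%:R :> R by rewrite ler1n.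
have stepN : N.+1%:R * step N = 1 by rewrite divff ?gt_eqF.
set s := N.+1%:R * x; have s0 : 0 < s by rewrite mulr_gt0.
pose j := Num.truncn s.
have /andP[js sj] : j%:R <= s < j.+1%:R := truncn_itv (ltW s0).
have jx : j.+1%:R <= N.+1%:R * (x + 1).
  by rewrite -natr1 mulrDr mulr1 lerD.
have sizeE : (size N)%:R = N.+1%:R ^+ 3 :> R by rewrite /size -lock natrX.
have jn : (j < size N)%N.
  rewrite -(ler_nat R) sizeE (le_trans jx)// exprS ler_pM2l//.
  by rewrite (le_trans xN)// ler_eXnr.
have := hausdorff_powR_moment (size_gt0 N) _ (weight_ge0 N) s0 jn.
rewrite sample0 js (ltW sj) f_le1// => /(_ isT isT) /andP[lb ub].
(* This is where the cube in [size] is needed: [i] is of order [N], so [i ^ 2 / N ^ 3] still tends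
   to [0]. *)
have err (i : R) : 0 <= i -> i <= N.+1%:R * (x + 1) ->
    i ^+ 2 / (size N)%:R <= (x + 1) ^+ 2 * step N.
  move=> i0 ix; rewrite ler_pdivrMr ?ltr0n// sizeE.
  have -> : (x + 1) ^+ 2 * step N * N.+1%:R ^+ 3 =
     (N.+1%:R * step N) * (N.+1%:R * (x + 1)) ^+ 2 by ring.
  rewrite stepN mul1r; apply: lerXn2r => //; rewrite nnegrE//.
  by rewrite (le_trans i0).
have xE : x = s * step N by rewrite /s mulrAC stepN mul1r.
apply/andP; split.
- apply: le_trans lb; apply: lerB; last exact: err.
  apply: f_le; first by rewrite mulr_gt0.
  rewrite xE -mulrDl ler_pM2r//.
  by rewrite -[j.+2%:R]natr1 -[j.+1%:R]natr1; lra.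
- apply: (le_trans ub); apply: lerD.
    by apply: f_le => //; rewrite xE ler_pM2r// ltW.
  by apply: err => //; rewrite (le_trans _ jx)// ler_nat.
Qed.

Let step_cvg0 : step N @[N --> \oo] --> (0 : R).
Proof. exact: cvg_harmonic. Qed.

Let Rintegral_level_cvg x : 0 < x ->
  \int[mu]_(u in `]0, 1]) (level N u `^ x) @[N --> \oo] --> f x.
Proof.
move=> x0.
have err0 : (x + 1) ^+ 2 * step N @[N --> \oo] --> 0.
  by rewrite -[X in _ --> X](mulr0 ((x + 1) ^+ 2)); exact: cvgMr.
apply: (squeeze_cvgr (f := fun N => f (x + 2 * step N) - (x + 1) ^+ 2 * step N)
                     (h := fun N => f x + (x + 1) ^+ 2 * step N)).
- near=> N; apply: Rintegral_level_bounds => //.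
  near: N; exists (Num.truncn (x + 1)) => // N /= xN.
  have /andP[_ /ltW/le_trans] := truncn_itv (ltW (addr_gt0 x0 ltr01)).
  by apply; rewrite ler_nat ltnS.
- rewrite -[X in _ --> X]subr0; apply: cvgB => //.
  apply: (@continuous_cvg _ _ _ _ _ (fun N => x + 2 * step N) f x); first exact: f_cont.
  rewrite -[X in _ --> X]addr0; apply: cvgD; first exact: cvg_cst.
  by rewrite -[X in _ --> X](mulr0 2); exact: cvgMr.
- by rewrite -[X in _ --> X]addr0; apply: cvgD => //; exact: cvg_cst.
Unshelve. all: by end_near. Qed.

Let powR_unit_le1 (y x : R) : 0 < x -> 0 <= y <= 1 -> y `^ x <= 1.
Proof.
move=> x0 /andP[y0 y1]; apply: (@le_trans _ _ (1 `^ x)); last by rewrite powR1.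
by apply: (ge0_ler_powR (ltW x0)); rewrite ?nnegrE.
Qed.

(* The quantile functions converge along an ultrafilter, pointwise; as they are monotone and
   bounded, Riemann sums approximate their integrals uniformly, so the integrals converge too. *)
Let exists_level_limit : exists Y : R -> R,
  [/\ nondecreasing_fun Y, forall u, 0 <= Y u <= 1 &
      forall x, 0 < x -> \int[mu]_(u in `]0, 1]) (Y u `^ x) = f x].
Proof.
have [U [UU ooU]] := ultraFilterLemma (@eventually_filter : ProperFilter \oo).
have /choice[Y Ylim] u := ultra_cvg_unit UU (v := level ^~ u)
  (fun N => introT andP (conj (level_ge0 N u) (level_le1 N u))).
exists Y.
have Y_le : nondecreasing_fun Y.
  move=> u v uv; apply: (ler_cvg_to (Ylim u) (Ylim v)).
  by apply: nearW => N; exact: level_le.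
have Y_01 u : 0 <= Y u <= 1.
  apply/andP; split.
    by apply: (cvgr_to_ge (Ylim u)); apply: nearW => N.
  by apply: (cvgr_to_le (Ylim u)); apply: nearW => N.
split=> // x x0.
have Yx_le : nondecreasing_fun (fun u => Y u `^ x).
  move=> u v uv; apply: (ge0_ler_powR (ltW x0)); rewrite ?nnegrE ?Y_le//.
    by have /andP[] := Y_01 u.
  by have /andP[] := Y_01 v.
set I := (LHS).
have close M : `|I - f x| <= 2 * step M.
  pose S (phi : R -> R) :=
    M.+1%:R^-1 * \sum_(0 <= i < M.+1) phi (i.+1%:R / M.+1%:R).
  have Ilim : \int[mu]_(u in `]0, 1]) (level N u `^ x) @[N --> U] --> f x.
    by apply: cvg_trans (Rintegral_level_cvg x0) => A /ooU.
  have Slim : S (fun u => level N u `^ x) @[N --> U] --> S (fun u => Y u `^ x).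
    apply: cvgMr; apply: cvg_big => //; first exact: add_continuous.
    by move=> i _; apply: cvg_powR_nneg.
  (* The subtracted norm tends to [0] along [U]; with it, the bound [2 * step M] holds for every
     [N]. *)
  have lim : `|I - \int[mu]_(u in `]0, 1]) (level N u `^ x)|
      - `|S (fun u => level N u `^ x) - S (fun u => Y u `^ x)| @[N --> U] -->
      `|I - f x| - `|S (fun u => Y u `^ x) - S (fun u => Y u `^ x)|.
    apply: cvgB; apply: cvg_norm; apply: cvgB => //; exact: cvg_cst.
  move: lim; rewrite (subrr (S _)) normr0 subr0 => lim.
  apply: (cvgr_to_le lim); apply: nearW => N.
  have h1 := nondecreasing_riemann_sum M (powR_level_le N x0).
  have h2 := nondecreasing_riemann_sum M Yx_le.
  have b1 : level N 1 `^ x - level N 0 `^ x <= 1.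
    by rewrite lerBlDr ler_wpDr ?powR_ge0// powR_unit_le1// level_ge0 level_le1.
  have b2 : Y 1 `^ x - Y 0 `^ x <= 1.
    by rewrite lerBlDr ler_wpDr ?powR_ge0// powR_unit_le1.
  have {}h1 := le_trans h1 (ler_piMr (ltW (step_gt0 M)) b1).
  have {}h2 := le_trans h2 (ler_piMr (ltW (step_gt0 M)) b2).
  rewrite lerBlDr.
  have -> : I - \int[mu]_(u in `]0, 1]) (level N u `^ x) =
      (I - S (fun u => Y u `^ x)) +
      ((S (fun u => level N u `^ x) - \int[mu]_(u in `]0, 1]) (level N u `^ x)) -
       (S (fun u => level N u `^ x) - S (fun u => Y u `^ x))) by ring.
  rewrite (le_trans (ler_normD _ _))// mulr_natl mulr2n -[leRHS]addrA lerD//.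
  by rewrite (le_trans (ler_normB _ _))// lerD2r distrC.
apply/eqP; rewrite -subr_eq0 -normr_le0.
have : 2 * step M @[M --> \oo] --> 0.
  by rewrite -[X in _ --> X](mulr0 2); exact: cvgMr.
by move=> /cvgr_to_ge; apply; exact: nearW.
Qed.

(** The measure is the law of [- ln (Y u)] for [u] uniform on [[0, 1]]: its Laplace transform at [x]
    is the integral of [Y u ^ x]. *)
Lemma bernstein : exists P : probability (measurableTypeR R) R,
  P `[0, +oo[%classic = 1%E /\ forall x, 0 < x -> laplace P x = f x.
Proof.
have [Y [Y_le Y_01 Y_int]] := exists_level_limit.
(* A zero of [Y] at [u > 0] forces [Y = 0] on []0, u]] by monotonicity, hence [f <= 1 - u]
   everywhere, against the limit [1] at [0]. So no mass escapes to infinity, and [ln] is never taken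
   at [0], where its value is a default. *)
have Y_gt0 u : 0 < u -> u <= 1 -> 0 < Y u.
  move=> u0 u1; have /andP[+ _] := Y_01 u.
  rewrite le_eqVlt => /predU1P[Yu|//]; exfalso.
  have f_bound x : 0 < x -> f x <= 1 - u.
    move=> x0; rewrite -(Y_int x x0).
    have ndx : nondecreasing_fun (fun u => Y u `^ x).
      move=> v w vw; apply: (ge0_ler_powR (ltW x0)); rewrite ?nnegrE ?Y_le//.
        by have /andP[] := Y_01 v.
      by have /andP[] := Y_01 w.
    rewrite (nondecreasing_Rintegral_split ndx (ltW u0) u1).
    have := nondecreasing_Rintegral_le ndx (ltW u0).
    have := nondecreasing_Rintegral_le ndx u1.
    rewrite -Yu powR0 ?gt_eqF// mul0r.
    have : Y 1 `^ x * (1 - u) <= 1 - u.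
      by rewrite ler_piMl ?subr_ge0// powR_unit_le1.
    lra.
  have : (1 : R) <= 1 - u.
    apply: (cvgr_to_le f_cvg1); near=> x; apply: f_bound.
    by near: x; exact: nbhs_right_gt.
  lra.
pose T u := - ln (Y u).
have T_ge0 u : 0 <= T u by rewrite oppr_ge0 ln_le0//; have /andP[] := Y_01 u.
have mT : measurable_fun setT T.
  apply: measurableT_comp => //; apply: measurableT_comp; first exact: measurable_ln.
  exact: nondecreasing_measurable.
pose mT_mixin := @isMeasurableFun.Build _ _ (measurableTypeR R) (measurableTypeR R) T mT.
pose X : {mfun measurableTypeR R >-> measurableTypeR R} := HB.pack T mT_mixin.
exists (distribution (uniform_prob (@ltr01 R)) X).
have preT : X @^-1` `[0, +oo[%classic = setT.
  by apply/seteqP; split=> // u _ /=; rewrite in_itv/= T_ge0.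
pose unif := uniform_prob (@ltr01 R).
split; first by rewrite -(@probability_setT _ _ _ unif) -preT.
move=> x x0; rewrite -(Y_int x x0) /laplace /Rintegral; congr fine.
have m_exp : measurable_fun setT (fun t : R => (expR (- (x * t)))%:E).
  apply/measurable_EFinP; apply: measurableT_comp => //.
  by apply: measurableT_comp => //; exact: measurable_funM.
transitivity (\int[unif]_u (expR (- (x * T u)))%:E)%E.
  rewrite ge0_integral_pushforward//; last exact: measurable_funTS.
  by rewrite [in LHS]preT.
rewrite integral_uniform; last 2 first.
- exact: (measurableT_comp m_exp mT).
- by move=> t; rewrite lee_fin expR_ge0.
rewrite subr0 invr1 mul1e -integral_itv_obnd_cbnd; last first.
  exact: measurable_funTS (measurableT_comp m_exp mT).
apply: eq_integral => u; rewrite inE/= in_itv/= => /andP[u0 u1]; congr EFin.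
by rewrite /T /powR gt_eqF ?Y_gt0// mulrN opprK.
Unshelve. all: by end_near. Qed.

End bernstein.

(** * Gamma function *)

Lemma is_derive1_inv (R : realType) (x : R) : x != 0 ->
  is_derive x 1 (@GRing.inv R) (- (x ^+ 2)^-1).
Proof.
move=> x0; split; first exact: derivableV.
by rewrite deriveV// derive_val /GRing.scale/= mulr1.
Qed.

Lemma is_derive1_continuous (R : realType) (f : R -> R) (x d : R) :
  is_derive x 1 f d -> {for x, continuous f}.
Proof. by move=> [df _]; apply: differentiable_continuous; exact/derivable1_diffP. Qed.

Section integrable_EFin.
Context d (T : measurableType d) (R : realType) (mu : {measure set T -> \bar R}).
Variables (D : set T) (mD : measurable D).
Implicit Types f g : T -> R.

Lemma integrable_EFinZ (c : R) f : mu.-integrable D (EFin \o f) ->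
  mu.-integrable D (EFin \o (fun t => c * f t)).
Proof.
move=> intf; rewrite (_ : _ \o _ = (fun t => c%:E * (f t)%:E)%E).
  exact: integrableZl intf.
by apply/funext => t; rewrite /= EFinM.
Qed.

Lemma integrable_EFinD f g : mu.-integrable D (EFin \o f) ->
  mu.-integrable D (EFin \o g) -> mu.-integrable D (EFin \o (fun t => f t + g t)).
Proof.
move=> intf intg; rewrite (_ : _ \o _ = (EFin \o f) \+ (EFin \o g))%E.
  exact: integrableD.
by apply/funext => t; rewrite /= EFinD.
Qed.

Lemma integrable_EFinB f g : mu.-integrable D (EFin \o f) ->
  mu.-integrable D (EFin \o g) -> mu.-integrable D (EFin \o (fun t => f t - g t)).
Proof.
move=> intf intg; rewrite (_ : _ \o _ = (EFin \o f) \- (EFin \o g))%E.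
  exact: integrableB.
by apply/funext => t; rewrite /= EFinB.
Qed.

End integrable_EFin.

Section integrable_0y.
Context {R : realType}.
Notation mu := (@lebesgue_measure R).
Implicit Types f g : R -> R.

Lemma integrable_0yZ (c : R) f : mu.-integrable `]0, +oo[ (EFin \o f) ->
  mu.-integrable `]0, +oo[ (EFin \o (fun t => c * f t)).
Proof. exact: integrable_EFinZ. Qed.

Lemma integrable_0yD f g : mu.-integrable `]0, +oo[ (EFin \o f) ->
  mu.-integrable `]0, +oo[ (EFin \o g) ->
  mu.-integrable `]0, +oo[ (EFin \o (fun t => f t + g t)).
Proof. exact: integrable_EFinD. Qed.

Lemma integrable_0yB f g : mu.-integrable `]0, +oo[ (EFin \o f) ->
  mu.-integrable `]0, +oo[ (EFin \o g) ->
  mu.-integrable `]0, +oo[ (EFin \o (fun t => f t - g t)).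
Proof. exact: integrable_EFinB. Qed.

End integrable_0y.

(** * Primitives and inversion on the open half-line *)

Section integral_0y.
Context {R : realType}.
Notation mu := (@lebesgue_measure R).
Implicit Types (f F : R -> R).

Variable c : R.
Hypothesis c_gt0 : 0 < c.

(* The scale [c] makes this exhaustion invariant under [x |-> c ^+ 2 / x]. *)
Let A (n : nat) : set R := `[c / n.+1%:R, c * n.+1%:R]%classic.

Let lo_gt0 n : 0 < c / n.+1%:R. Proof. by rewrite divr_gt0. Qed.

Let bigcup_A : \bigcup_n A n = `]0, +oo[%classic.
Proof.
apply/seteqP; split=> x /=.
  by move=> [n _]; rewrite /A /= !in_itv/= andbT => /andP[/(lt_le_trans (lo_gt0 n))].
rewrite in_itv/= andbT => x0.
have m0 : 0 <= x / c + c / x by rewrite addr_ge0// divr_ge0// ltW.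
exists (Num.truncn (x / c + c / x)) => //; rewrite /A/= in_itv/=.
have /andP[_ /ltW ub] := truncn_itv m0; apply/andP; split.
  rewrite ler_pdivrMr// mulrC -ler_pdivrMr//.
  by rewrite (le_trans _ ub)// lerDr divr_ge0// ltW.
rewrite mulrC -ler_pdivrMr//.
by rewrite (le_trans _ ub)// lerDl divr_ge0// ltW.
Qed.

Let A_le : {homo A : n m / (n <= m)%N >-> (n <= m)%O}.
Proof.
move=> n m nm; rewrite subsetEset => x; rewrite /A/= !in_itv/= => /andP[a b].
apply/andP; split; last by rewrite (le_trans b)// ler_pM2l// ler_nat.
by rewrite (le_trans _ a)// ler_pM2l// lef_pV2 ?posrE// ler_nat.
Qed.

Let mA n : measurable (A n). Proof. exact: measurable_itv. Qed.

Let A_sub n : A n `<=` `]0, +oo[%classic.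
Proof. by rewrite -bigcup_A; exact: bigcup_sup. Qed.

Let cvg_integral_0y f : (forall x, 0 < x -> 0 <= f x) ->
  measurable_fun (`]0, +oo[%classic : set R) f ->
  (\int[mu]_(x in A n) (f x)%:E)%E @[n --> \oo] -->
  (\int[mu]_(x in `]0%R, +oo[) (f x)%:E)%E.
Proof.
move=> f0 mf; rewrite -bigcup_A.
apply: ge0_nondecreasing_set_cvg_integral => //.
- move=> n; apply/measurable_EFinP; apply: measurable_funS mf => //; exact: A_sub.
- move=> n x; rewrite /A/= in_itv/= => /andP[+ _].
  by move=> /(lt_le_trans (lo_gt0 n)) /f0; rewrite lee_fin.
Qed.

Let cvg_Rintegral_0y_ge0 f : (forall x, 0 < x -> 0 <= f x) ->
  mu.-integrable `]0, +oo[ (EFin \o f) ->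
  \int[mu]_(x in A n) f x @[n --> \oo] --> \int[mu]_(x in `]0, +oo[) f x.
Proof.
move=> f0 intf; apply: fine_cvg; rewrite fineK.
  apply: cvg_integral_0y => //.
  by apply/measurable_EFinP; exact: measurable_int intf.
exact: integrable_fin_num.
Qed.

(** The nonnegative case applied to [f + |f|] and [|f|]. *)
Let cvg_Rintegral_0y f : mu.-integrable `]0, +oo[ (EFin \o f) ->
  \int[mu]_(x in A n) f x @[n --> \oo] --> \int[mu]_(x in `]0, +oo[) f x.
Proof.
move=> intf.
have intn : mu.-integrable `]0, +oo[ (EFin \o (fun x => `|f x|)).
  exact: (integrable_norm intf).
have intD : mu.-integrable `]0, +oo[ (EFin \o (fun x => f x + `|f x|)).
  exact: integrable_EFinD.
have E (B : set R) : measurable B -> B `<=` `]0, +oo[%classic ->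
    \int[mu]_(x in B) f x =
    \int[mu]_(x in B) (f x + `|f x|) - \int[mu]_(x in B) `|f x|.
  move=> mB BA; rewrite -RintegralB//.
  - by apply: eq_Rintegral => x _; rewrite addrK.
  - exact: integrableS intD.
  - exact: integrableS intn.
rewrite E//; under eq_cvg do rewrite E//.
apply: cvgB; apply: cvg_Rintegral_0y_ge0 => //.
by move=> x _; rewrite addrC -lerBlDr sub0r lerNl lerNnormlW.
Qed.

Let A_gt0 n x : A n x -> 0 < x.
Proof. by move/A_sub; rewrite /= in_itv/= andbT. Qed.

Let continuous_within_A f n : (forall x, 0 < x -> {for x, continuous f}) ->
  {within A n, continuous f}.
Proof.
by move=> cf; apply: continuous_in_subspaceT => x; rewrite inE => /A_gt0; exact: cf.
Qed.

Let FTC_A f F n : (forall x : R, 0 < x -> is_derive x 1 F (f x)) ->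
  (forall x, 0 < x -> {for x, continuous f}) ->
  \int[mu]_(x in A n.+1) f x = F (c * n.+2%:R) - F (c / n.+2%:R).
Proof.
move=> dF cf.
have cF x : 0 < x -> {for x, continuous F}.
  by move=> /dF; exact: is_derive1_continuous.
have lt : c / n.+2%:R < c * n.+2%:R.
  by rewrite ltr_pM2l// (@lt_trans _ _ 1) ?invf_lt1 ?ltr1n.
rewrite /Rintegral (continuous_FTC2 (F := F))//.
- exact: continuous_within_A.
- split.
  + by move=> x /subset_itv_oo_cc /A_gt0 /dF [].
  + by apply: cvg_at_right_filter; apply: cF.
  + by apply: cvg_at_left_filter; apply: cF; rewrite mulr_gt0.
- by move=> x /subset_itv_oo_cc /A_gt0 /dF dFx; rewrite derive1E derive_val.
Qed.

(** On each segment the integral is an increment of [F], hence at most [B]; monotone convergence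
    carries this bound to the half-line. *)
Lemma integrable_0y_antiderivative f F (B : R) :
  (forall x : R, 0 < x -> is_derive x 1 F (f x)) ->
  (forall x, 0 < x -> {for x, continuous f}) ->
  (forall x, 0 < x -> 0 <= f x) -> (forall x, 0 < x -> 0 <= F x <= B) ->
  mu.-integrable `]0, +oo[ (EFin \o f).
Proof.
move=> dF cf f0 F0B.
have mf : measurable_fun (`]0, +oo[%classic : set R) f.
  apply: open_continuous_measurable_fun; first exact: interval_open.
  by move=> x; rewrite inE/= in_itv/= andbT; exact: cf.
apply/integrableP; split; first exact/measurable_EFinP.
have -> : (\int[mu]_(x in `]0%R, +oo[) `|(EFin \o f) x| =
    \int[mu]_(x in `]0%R, +oo[) (f x)%:E)%E.
  apply: eq_integral.
  by move=> x; rewrite inE/= in_itv/= andbT => /f0 fx /=; rewrite ger0_norm.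
apply: (@le_lt_trans _ _ B%:E); last exact: ltry.
have := cvg_integral_0y f0 mf; rewrite -cvg_shiftS => /cvge_to_le; apply.
apply: nearW => n.
have fin : (\int[mu]_(x in A n.+1) (f x)%:E)%E \is a fin_num.
  have : mu.-integrable (A n.+1) (EFin \o f); last by move=> /integrable_fin_num; apply; exact: mA.
  apply: continuous_compact_integrable; first exact: segment_compact.
  exact: continuous_within_A.
rewrite /= -(fineK fin) lee_fin.
have := FTC_A n dF cf; rewrite /Rintegral => ->.
have /andP[_ b] := F0B _ (mulr_gt0 c_gt0 (ltr0Sn R n.+1)).
have /andP[a _] := F0B _ (lo_gt0 n.+1).
by rewrite lerBlDr (le_trans b)// lerDl.
Qed.

Let cvg_hi : (c * n.+2%:R) @[n --> \oo] --> +oo.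
Proof.
apply/cvgryPge => M; exists (Num.truncn (`|M| / c)) => // n /= Mn.
rewrite mulrC -ler_pdivrMr//.
have /andP[_ /ltW ub] := truncn_itv (divr_ge0 (normr_ge0 M) (ltW c_gt0)).
rewrite (@le_trans _ _ (`|M| / c)) ?ler_pM2r ?invr_gt0 ?ler_norm//.
by rewrite (le_trans ub)// ler_nat ltnS ltnW.
Qed.

Let cvg_lo : (c / n.+2%:R) @[n --> \oo] --> (0 : R).
Proof.
rewrite -[X in _ --> X](mulr0 c); apply: cvgMr.
by have := @cvg_harmonic R; rewrite -cvg_shiftS.
Qed.

Lemma Rintegral_0y_derivative f F (l0 l1 : R) :
  mu.-integrable `]0, +oo[ (EFin \o f) ->
  (forall x : R, 0 < x -> is_derive x 1 F (f x)) ->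
  (forall x, 0 < x -> {for x, continuous f}) ->
  F x @[x --> 0^'+] --> l0 -> F x @[x --> +oo] --> l1 ->
  \int[mu]_(x in `]0, +oo[) f x = l1 - l0.
Proof.
move=> intf dF cf Fl0 Fl1.
have lim : \int[mu]_(x in A n.+1) f x @[n --> \oo] --> \int[mu]_(x in `]0, +oo[) f x.
  by have := cvg_Rintegral_0y intf; rewrite -cvg_shiftS.
apply: (cvg_unique _ lim) => //=.
under eq_cvg do rewrite (FTC_A _ dF cf).
apply: cvgB; first exact: (cvg_comp _ _ cvg_hi Fl1).
by move/cvg_at_rightP : Fl0; apply; split => // n; exact: lo_gt0.
Qed.

Lemma Rintegral_0y_inversion f :
  (forall x, 0 < x -> {for x, continuous f}) ->
  mu.-integrable `]0, +oo[ (EFin \o f) ->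
  mu.-integrable `]0, +oo[ (EFin \o (fun x => f (c ^+ 2 / x) * (c ^+ 2 / x ^+ 2))) ->
  \int[mu]_(x in `]0, +oo[) (f (c ^+ 2 / x) * (c ^+ 2 / x ^+ 2)) =
  \int[mu]_(x in `]0, +oo[) f x.
Proof.
move=> cf intf intg.
pose F x : R := c ^+ 2 / x.
have dF (x : R) : 0 < x -> is_derive x 1 F (- (c ^+ 2 / x ^+ 2)).
  move=> x0; have xn0 : x != 0 by rewrite gt_eqF.
  pose dV := is_derive1_inv xn0.
  by apply: is_derive_eq; rewrite /GRing.scale/=; field.
have cF x : 0 < x -> {for x, continuous F}.
  by move=> /dF; exact: is_derive1_continuous.
have cdF (x : R) : 0 < x -> {for x, continuous F^`()%classic}.
  move=> x0.
  have E z : 0 < z -> F^`()%classic z = - (c ^+ 2 / z ^+ 2).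
    by move=> /dF dFz; rewrite derive1E derive_val.
  rewrite /prop_for /continuous_at (E x x0).
  apply: (@cvg_trans _ ((fun z : R => - (c ^+ 2 / z ^+ 2)) @ x)).
    apply: near_eq_cvg; near=> z; rewrite E//.
    by near: z; exact: lt_nbhsr.
  have xn0 : x ^+ 2 != 0 by rewrite expf_neq0 ?gt_eqF.
  pose dV := is_derive1_inv xn0.
  exact: (@is_derive1_continuous R (fun z => - (c ^+ 2 / z ^+ 2)) x).
have step n : \int[mu]_(x in A n) (f (c ^+ 2 / x) * (c ^+ 2 / x ^+ 2)) =
    \int[mu]_(x in A n) f x.
  have FA : F (c / n.+1%:R) = c * n.+1%:R /\ F (c * n.+1%:R) = c / n.+1%:R.
    by rewrite /F; split; field; rewrite ?gt_eqF ?pnatr_eq0.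
  have [FA1 FA2] := FA.
  have := @integration_by_substitution_decreasing R F f (c / n.+1%:R) (c * n.+1%:R).
  rewrite FA1 FA2 => subst.
  rewrite /Rintegral; congr fine; rewrite subst.
  - apply: eq_integral => x; rewrite inE => /A_gt0 /dF dFx.
    rewrite -[RHS]/((f (F x) * - F^`()%classic x)%:E).
    by rewrite derive1E derive_val opprK.
  - by rewrite ler_pM2l// (@le_trans _ _ 1) ?invf_le1 ?ler1n.
  - move=> x y /A_gt0 x0 /A_gt0 y0 xy.
    by rewrite ltr_pM2l ?exprn_gt0// ltf_pV2.
  - by move=> x /subset_itv_oo_cc /A_gt0; exact: cdF.
  - by apply: cvgP; apply: cvg_at_right_filter; exact: cdF.
  - by apply: cvgP; apply: cvg_at_left_filter; apply: cdF; rewrite mulr_gt0.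
  - split.
    + by move=> x /subset_itv_oo_cc /A_gt0 /dF [].
    + by apply: cvg_at_right_filter; apply: cF.
    + by apply: cvg_at_left_filter; apply: cF; rewrite mulr_gt0.
  - exact: continuous_within_A.
apply: (cvg_unique _ (cvg_Rintegral_0y intg)) => //=.
by under eq_cvg do rewrite step; exact: cvg_Rintegral_0y.
Unshelve. all: by end_near. Qed.

End integral_0y.

(** * Euler's integrand damped at the origin *)

Section gamma_kernel.
Context {R : realType}.
Notation mu := (@lebesgue_measure R).
Implicit Types s t y : R.

(** The integrand of the overview's [M_s y], which equals [2 y ^ (s / 2) K_s (2 sqrt y)] for
    [s, y > 0] by [besselKE]. At [y = 0] it is the integrand of [Gamma s]. *)
Definition gkernel s y t : R := t `^ (s - 1) * expR (- (t + y / t)).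

Definition gintegral s y : R := \int[mu]_(t in `]0, +oo[) gkernel s y t.

Lemma gkernel_ge0 s y t : 0 <= gkernel s y t.
Proof. by rewrite mulr_ge0 ?powR_ge0 ?expR_ge0. Qed.

Lemma expRN_le_fact (u : R) k : 0 < u -> expR (- u) <= k.+1`!%:R / u ^+ k.+1.
Proof.
move=> u0; rewrite expRN -[leRHS]invrK lef_pV2 ?posrE ?invr_gt0 ?expR_gt0//; last first.
  by rewrite divr_gt0 ?exprn_gt0// ltr0n fact_gt0.
rewrite invf_div (le_trans _ (expR_ge1Dxn k (ltW u0)))//.
by rewrite lerDr.
Qed.

Lemma powR_expRN_bounded s : exists2 C : R, 0 < C &
  forall t, 1 <= t -> t `^ s * expR (- t) <= C.
Proof.
pose k := Num.truncn `|s|; exists k.+1`!%:R; first by rewrite ltr0n fact_gt0.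
move=> t t1; have t0 : 0 < t by rewrite (lt_le_trans _ t1).
have sk : s <= k.+1%:R.
  rewrite (le_trans (ler_norm s))//.
  by have /andP[_ /ltW] := truncn_itv (normr_ge0 s).
rewrite (le_trans (ler_wpM2r (expR_ge0 _) (ler_powR t1 sk)))//.
rewrite powR_mulrn ?(ltW t0)// mulrC -ler_pdivlMr ?exprn_gt0//.
exact: expRN_le_fact.
Qed.

Lemma gkernel_primitive s y t : 0 < t ->
  is_derive t 1 (fun t => t `^ s * expR (- (t + y / t)))
    (s * gkernel s y t - gkernel (s + 1) y t + y * gkernel (s - 1) y t).
Proof.
move=> t0; have tn0 : t != 0 by rewrite gt_eqF.
pose dV := is_derive1_inv tn0.
pose dP := is_derive1_powR s t0.
apply: is_derive_eq; rewrite /gkernel /GRing.scale/= addrK.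
have e : t `^ (s - 1 - 1) = t `^ s / t ^+ 2.
  rewrite -addrA -opprD powRB ?tn0 ?implybT//.
  by rewrite -[1 + 1 in X in _ / X]/(2%:R) powR_mulrn ?ltW.
rewrite e; ring.
Qed.

Lemma gkernel_continuous s y t : 0 < t -> {for t, continuous (gkernel s y)}.
Proof. by move=> t0; have := gkernel_primitive (s - 1) y t0; exact: is_derive1_continuous. Qed.

Lemma measurable_gkernel s y :
  measurable_fun (`]0, +oo[%classic : set R) (gkernel s y).
Proof.
apply: open_continuous_measurable_fun; first exact: interval_open.
by move=> x; rewrite inE/= in_itv/= andbT; exact: gkernel_continuous.
Qed.

(** The derivative of [- 1 / (1 + t ^ s)]: a dominating function with a bounded elementary
    primitive, of size [t ^ (s - 1)] at [0] and [t ^ (- s - 1)] at infinity. *)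
Let dom s t := s * t `^ (s - 1) * ((1 + t `^ s) ^+ 2)^-1.

Let integrable_dom s : 0 < s -> mu.-integrable `]0, +oo[ (EFin \o dom s).
Proof.
move=> s0; have p0 t : 0 < 1 + t `^ s by rewrite ltr_wpDr ?powR_ge0.
apply: (@integrable_0y_antiderivative R 1 ltr01 (dom s) (fun t => - (1 + t `^ s)^-1 + 1) 1).
- move=> t t0; pose dP := is_derive1_powR s t0.
  have pn0 : 1 + t `^ s != 0 by rewrite gt_eqF.
  pose dV := is_derive1_inv pn0.
  by apply: is_derive_eq; rewrite /dom /GRing.scale/=; ring.
- move=> t t0; pose dP := is_derive1_powR s t0.
  pose dP' := is_derive1_powR (s - 1) t0.
  have pn0 : (1 + t `^ s) ^+ 2 != 0 by rewrite expf_neq0// gt_eqF.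
  pose dV := is_derive1_inv pn0.
  exact: (@is_derive1_continuous R (dom s) t).
- by move=> t t0; rewrite !mulr_ge0 ?invr_ge0 ?exprn_ge0 ?powR_ge0 ?ltW.
- move=> t t0; rewrite addrC subr_ge0 lerBlDr lerDl invr_ge0 (ltW (p0 t)) andbT.
  by rewrite invf_le1// lerDl powR_ge0.
Qed.

Lemma integrable_gkernel_pos s y : 0 < s -> 0 <= y ->
  mu.-integrable `]0, +oo[ (EFin \o gkernel s y).
Proof.
move=> s0 y0.
have [C C0 hC] := powR_expRN_bounded (s + s).
(* After division by [t ^ (s - 1)] it remains to bound [exp (- t) (1 + t ^ s) ^ 2] by [4 (1 + C)]:
   it is at most [4] for [t <= 1], and at most [4 t ^ (2 s) exp (- t) <= 4 C] beyond. *)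
have intC : mu.-integrable `]0, +oo[ (EFin \o (fun t => (4 * (1 + C) / s) * dom s t)).
  exact: integrable_EFinZ (integrable_dom s0).
apply: le_integrable intC => //.
  apply/measurable_EFinP; exact: measurable_gkernel.
move=> t /=; rewrite in_itv/= andbT => t0; rewrite lee_fin.
rewrite ger0_norm ?gkernel_ge0// (le_trans _ (ler_norm _))//.
have p0 : 0 < 1 + t `^ s by rewrite ltr_wpDr ?powR_ge0.
have -> : 4 * (1 + C) / s * dom s t = t `^ (s - 1) * (4 * (1 + C) / (1 + t `^ s) ^+ 2).
  by rewrite /dom; field; rewrite !gt_eqF.
rewrite ler_wpM2l ?powR_ge0// ler_pdivlMr ?exprn_gt0//.
rewrite (@le_trans _ _ (expR (- t) * (1 + t `^ s) ^+ 2))//.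
  by rewrite ler_wpM2r ?exprn_ge0 ?(ltW p0)// ler_expR lerN2 lerDl divr_ge0// ltW.
have et1 : expR (- t) <= 1 by rewrite expR_le1 oppr_le0 ltW.
have [t1|t1] := leP t 1.
  have ts1 : t `^ s <= 1.
    apply: (@le_trans _ _ (1 `^ s)); last by rewrite powR1.
    by apply: (ge0_ler_powR (ltW s0)); rewrite ?nnegrE ?(ltW t0).
  rewrite (@le_trans _ _ (1 * 4))//; last by rewrite mul1r ler_peMr// lerDl ltW.
  apply: ler_pM => //; rewrite ?expR_ge0 ?exprn_ge0 ?(ltW p0)//.
  have := powR_ge0 t s; nra.
have ts1 : 1 <= t `^ s.
  by rewrite -(powRr0 t); apply: ler_powR; exact: ltW.
have tn0 : t != 0 by rewrite gt_eqF.
have := hC t (ltW t1); rewrite powRD ?tn0 ?implybT//.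
rewrite (_ : t `^ s * t `^ s = (t `^ s) ^+ 2) ?expr2// => h.
rewrite (@le_trans _ _ (4 * ((t `^ s) ^+ 2 * expR (- t))))//; last first.
  by rewrite ler_pM2l// (le_trans h)// lerDr.
rewrite mulrC mulrA ler_wpM2r ?expR_ge0//; nra.
Qed.

(** [exp (- y / t) <= (k + 1)! (t / y) ^ (k + 1)]: the order rises by [k + 1] at the price of a
    power of [1 / y]. This gives integrability at every order and the decay in [y] used later. *)
Lemma gkernel_le s y t k : 0 < y -> 0 < t ->
  gkernel s y t <= k.+1`!%:R / y ^+ k.+1 * gkernel (s + k.+1%:R) 0 t.
Proof.
move=> y0 t0; rewrite /gkernel mul0r addr0 opprD expRD.
have -> : t `^ (s + k.+1%:R - 1) = t `^ (s - 1) * t ^+ k.+1.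
  have tn0 : t != 0 by rewrite gt_eqF.
  rewrite (_ : s + k.+1%:R - 1 = (s - 1) + k.+1%:R); last by ring.
  by rewrite (@powRD _ t (s - 1) k.+1%:R) ?tn0 ?implybT// powR_mulrn// ltW.
have -> : k.+1`!%:R / y ^+ k.+1 * (t `^ (s - 1) * t ^+ k.+1 * expR (- t)) =
    t `^ (s - 1) * (expR (- t) * (k.+1`!%:R / (y / t) ^+ k.+1)).
  rewrite expr_div_n; field; rewrite !expf_neq0 ?gt_eqF//.
rewrite ler_wpM2l ?powR_ge0// ler_wpM2l ?expR_ge0//.
by apply: expRN_le_fact; rewrite divr_gt0.
Qed.

Let shift_pos s : exists k : nat, 0 < s + k.+1%:R.
Proof.
exists (Num.truncn `|s|); have /andP[_] := truncn_itv (normr_ge0 s).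
by rewrite -ltrBlDl sub0r; apply: le_lt_trans; rewrite -normrN ler_norm.
Qed.

Lemma integrable_gkernel s y : 0 < y ->
  mu.-integrable `]0, +oo[ (EFin \o gkernel s y).
Proof.
move=> y0; have [k sk0] := shift_pos s.
have intC : mu.-integrable `]0, +oo[
    (EFin \o (fun t => k.+1`!%:R / y ^+ k.+1 * gkernel (s + k.+1%:R) 0 t)).
  exact: integrable_EFinZ (integrable_gkernel_pos sk0 (lexx 0)).
apply: le_integrable intC => //.
  apply/measurable_EFinP; exact: measurable_gkernel.
move=> t /=; rewrite in_itv/= andbT => t0; rewrite lee_fin.
rewrite ger0_norm ?gkernel_ge0// (le_trans _ (ler_norm _))//.
exact: gkernel_le.
Qed.

Lemma gintegral_ge0 s y : 0 <= gintegral s y.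
Proof. by apply: Rintegral_ge0 => t _; exact: gkernel_ge0. Qed.

Lemma gintegral_le s y k : 0 < y -> 0 < s + k.+1%:R ->
  gintegral s y <= k.+1`!%:R / y ^+ k.+1 * gintegral (s + k.+1%:R) 0.
Proof.
move=> y0 sk0; have int0 := integrable_gkernel_pos sk0 (lexx 0).
rewrite /gintegral -RintegralZl//; apply: le_Rintegral => //.
- exact: integrable_gkernel.
- exact: integrable_EFinZ.
- by move=> t /=; rewrite in_itv/= andbT => t0; exact: gkernel_le.
Qed.

End gamma_kernel.

Section gamma_integral.
Context {R : realType}.
Notation mu := (@lebesgue_measure R).
Implicit Types s t y : R.

Let powR_cvg_y s : 0 < s -> t `^ (- s) @[t --> (+oo%R : set_system R)] --> (0 : R).
Proof.
move=> s0; apply/cvgrPdist_le => e e0; near=> t.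
have t0 : 0 < t by near: t; exact: nbhs_pinfty_gt (num_real _).
rewrite sub0r normrN ger0_norm ?powR_ge0//.
have -> : e = (e `^ (- s^-1)) `^ (- s).
  by rewrite -powRrM mulrNN mulVf ?gt_eqF// powRr1// ltW.
rewrite !powRN lef_pV2 ?posrE ?powR_gt0// ?invr_gt0 ?powR_gt0//.
apply: (ge0_ler_powR (ltW s0)); rewrite ?nnegrE ?powR_ge0 ?invr_ge0 ?powR_ge0 ?(ltW t0)//.
Unshelve. all: by end_near. Qed.

Lemma gkernel_boundary_y s y : 0 <= y ->
  t `^ s * expR (- (t + y / t)) @[t --> (+oo%R : set_system R)] --> (0 : R).
Proof.
move=> y0; have [C C0 hC] := powR_expRN_bounded (s + 1).
apply: (@squeeze_cvgr _ _ _ _ (cst 0) (fun t => C * t `^ (- 1))).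
- near=> t.
  have t1 : 1 <= t by near: t; exact: nbhs_pinfty_ge (num_real _).
  have t0 : 0 < t by rewrite (lt_le_trans _ t1).
  have tn0 : t != 0 by rewrite gt_eqF.
  rewrite mulr_ge0 ?powR_ge0 ?expR_ge0//= powR_inv1 ?(ltW t0)// ler_pdivlMr//.
  apply: le_trans (hC t t1); rewrite powRD ?tn0 ?implybT// powRr1 ?(ltW t0)//.
  rewrite mulrAC ler_wpM2l ?mulr_ge0 ?powR_ge0 ?(ltW t0)//.
  by rewrite ler_expR lerN2 lerDl divr_ge0// ltW.
- exact: cvg_cst.
- by rewrite -[X in _ --> X](mulr0 C); apply: cvgMr; exact: powR_cvg_y.
Unshelve. all: by end_near. Qed.

Lemma gkernel_boundary_0_pos s y : 0 < s -> 0 <= y ->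
  t `^ s * expR (- (t + y / t)) @[t --> 0^'+] --> (0 : R).
Proof.
move=> s0 y0; apply: (@squeeze_cvgr _ _ _ _ (cst 0) (fun t => t `^ s)).
- near=> t; have t0 : 0 < t by near: t; exact: nbhs_right_gt.
  rewrite mulr_ge0 ?powR_ge0 ?expR_ge0//= ler_piMr ?powR_ge0//.
  by rewrite expR_le1 oppr_le0 addr_ge0 ?divr_ge0// ltW.
- exact: cvg_cst.
- exact: powR_cvg0.
Unshelve. all: by end_near. Qed.

Let boundary_0 s y : 0 < y ->
  t `^ s * expR (- (t + y / t)) @[t --> 0^'+] --> (0 : R).
Proof.
move=> y0.
pose k := Num.truncn `|s|.
have sk : 0 < s + k.+1%:R.
  have /andP[_] := truncn_itv (normr_ge0 s).
  by rewrite -ltrBlDl sub0r; apply: le_lt_trans; rewrite -normrN ler_norm.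
apply: (@squeeze_cvgr _ _ _ _ (cst 0)
  (fun t => k.+1`!%:R / y ^+ k.+1 * (t `^ (s + k.+1%:R) * expR (- (t + 0 / t))))).
- near=> t; have t0 : 0 < t by near: t; exact: nbhs_right_gt.
  rewrite mulr_ge0 ?powR_ge0 ?expR_ge0//=.
  have := gkernel_le (s + 1) k y0 t0; rewrite /gkernel addrK.
  by rewrite (_ : s + 1 + k.+1%:R - 1 = s + k.+1%:R)//; ring.
- exact: cvg_cst.
- rewrite -[X in _ --> X](mulr0 (k.+1`!%:R / y ^+ k.+1)); apply: cvgMr.
  exact: gkernel_boundary_0_pos.
Unshelve. all: by end_near. Qed.

(** Integration of the derivative of [t ^ s exp (- t - y / t)], which vanishes at both ends. *)
Lemma gintegral_rec s y : 0 < y ->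
  gintegral (s + 1) y = s * gintegral s y + y * gintegral (s - 1) y.
Proof.
move=> y0.
have i0 := integrable_gkernel s y0.
have i1 := integrable_gkernel (s + 1) y0.
have i2 := integrable_gkernel (s - 1) y0.
have i01 := integrable_0yB (integrable_0yZ s i0) i1.
have i2' := integrable_0yZ y i2.
have := @Rintegral_0y_derivative R 1 ltr01
  (fun t => s * gkernel s y t - gkernel (s + 1) y t + y * gkernel (s - 1) y t)
  (fun t => t `^ s * expR (- (t + y / t))) 0 0 (integrable_0yD i01 i2').
rewrite subrr RintegralD// RintegralB//; last exact: integrable_0yZ.
rewrite !RintegralZl// -/(gintegral _ _) -/(gintegral _ _) -/(gintegral _ _) => h.
apply/eqP; rewrite -subr_eq0 -oppr_eq0 opprB addrAC; apply/eqP; apply: h.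
- by move=> t t0; exact: gkernel_primitive.
- move=> t t0; apply: cvgD; last by apply: cvgMr; exact: gkernel_continuous.
  by apply: cvgB; [apply: cvgMr|]; exact: gkernel_continuous.
- exact: boundary_0.
- by apply: gkernel_boundary_y; exact: ltW.
Qed.

End gamma_integral.

Section gamma_function.
Context {R : realType}.
Notation mu := (@lebesgue_measure R).
Implicit Types s t y : R.

Lemma gintegral_gt0 s y : 0 <= y -> (0 < y) || (0 < s) -> 0 < gintegral s y.
Proof.
move=> y0 ys.
have ints : mu.-integrable `]0, +oo[ (EFin \o gkernel s y).
  by case/orP: ys => [|?]; [exact: integrable_gkernel|exact: integrable_gkernel_pos].
(* A lower bound of the kernel on []1, 2]]: there [0 <= ln t <= 1] and [t + y / t <= 2 + y]. *)
pose c := expR (- `|s - 1|) * expR (- (2 + y)).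
have c0 : 0 < c by rewrite mulr_gt0 ?expR_gt0.
have cle t : 1 < t <= 2 -> c <= gkernel s y t.
  move=> /andP[t1 t2]; have t0 : 0 < t by rewrite (lt_trans _ t1).
  apply: ler_pM; rewrite ?expR_ge0//.
    rewrite /powR gt_eqF// ler_expR lerNl -mulNr.
    rewrite (le_trans (ler_norm _))// normrM normrN ler_piMr// ger0_norm ?ln_ge0 ?(ltW t1)//.
    have t1' : -1 < t - 1 by lra.
    by have := le_ln1Dx t1'; rewrite [1 + _]addrC subrK; lra.
  rewrite ler_expR lerN2 lerD// ler_pdivrMr//; nra.
apply: (lt_le_trans c0).
have -> : c = \int[mu]_(t in `]1, 2]) c.
  by rewrite (@Rintegral_const_itv _ (fun=> c) 1 2 c)//; [ring|rewrite ler1n].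
have sub : `]1, 2] `<=` (`]0, +oo[ : set R).
  by move=> t /=; rewrite !in_itv/= andbT => /andP[/(lt_trans _)->].
have ints12 : mu.-integrable `]1, 2] (EFin \o gkernel s y).
  exact: integrableS ints.
apply: (@le_trans _ _ (\int[mu]_(t in `]1, 2]) gkernel s y t)).
  apply: le_Rintegral => //.
  by apply: (@nondecreasing_integrable R (fun=> c)) => ? ? _.
apply: fine_le.
- exact: integrable_fin_num ints12.
- exact: integrable_fin_num ints.
- apply: ge0_subset_integral => //.
    by apply/measurable_EFinP; exact: measurable_gkernel.
  by move=> t _; rewrite lee_fin gkernel_ge0.
Qed.

Lemma Gamma_gintegral s : 0 < s -> Gamma s = gintegral s 0.
Proof.
move=> s0; rewrite /Gamma /Gamma_shift s0 big_ord0 divr1 addr0.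
by apply: eq_Rintegral => t _; rewrite /gkernel mul0r addr0.
Qed.

Lemma Gamma_gt0 s : 0 < s -> 0 < Gamma s.
Proof. by move=> s0; rewrite Gamma_gintegral// gintegral_gt0// s0 orbT. Qed.

Lemma GammaS s : 0 < s -> Gamma (s + 1) = s * Gamma s.
Proof.
move=> s0; rewrite !Gamma_gintegral// ?addr_gt0//.
have i0 := integrable_gkernel_pos s0 (lexx 0).
have i1 := integrable_gkernel_pos (addr_gt0 s0 ltr01) (lexx 0).
have := @Rintegral_0y_derivative R 1 ltr01
  (fun t => s * gkernel s 0 t - gkernel (s + 1) 0 t)
  (fun t => t `^ s * expR (- (t + 0 / t))) 0 0 (integrable_0yB (integrable_0yZ s i0) i1).
rewrite subrr RintegralB//; last exact: integrable_0yZ.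
rewrite !RintegralZl// -/(gintegral _ _) -/(gintegral _ _) => h.
apply/esym/eqP; rewrite -subr_eq0; apply/eqP; apply: h.
- move=> t t0; have := gkernel_primitive s 0 t0.
  by rewrite mul0r addr0.
- by move=> t t0; apply: cvgB; [apply: cvgMr|]; exact: gkernel_continuous.
- exact: gkernel_boundary_0_pos.
- exact: gkernel_boundary_y.
Qed.

(** For [s <= 0] the product defining [Gamma s] has exactly one more factor than that of
    [Gamma (s + 1)], namely [s]. Poles are included, since [1 / Gamma] is [0] there. *)
Lemma invGammaE s : (Gamma s)^-1 = s * (Gamma (s + 1))^-1.
Proof.
have [s0|s0] := ltP 0 s.
  by rewrite GammaS// (invfM s (Gamma s)) mulVKf// gt_eqF.
have shiftE : Gamma_shift s = (Gamma_shift (s + 1)).+1.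
  rewrite /Gamma_shift ltNge s0/=; congr S.
  have [s1|s1] := ltP 0 (s + 1).
    apply: (@truncn_def R (- s) 0); apply/andP; split; lra.
  have s1' : 0 <= - (s + 1) by lra.
  have /andP[lb ub] := truncn_itv s1'.
  apply: truncn_def; rewrite -!natr1 in ub *; apply/andP; split; lra.
rewrite /Gamma shiftE; set m := Gamma_shift (s + 1).
rewrite !invf_div big_ord_recl addr0 (_ : s + m.+1%:R = s + 1 + m%:R); last first.
  by rewrite -natr1; ring.
rewrite -mulrA; congr (_ * (_ / _)); apply: eq_bigr => i _.
by rewrite lift0 -natr1; ring.
Qed.

(** The substitution [t -> y / t] exchanges the two terms of the exponent [t + y / t]; it is the
    inversion with [c = sqrt y]. *)
Lemma gintegral_inv s y : 0 < y -> gintegral s y = y `^ s * gintegral (- s) y.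
Proof.
move=> y0; have yn0 : y != 0 by rewrite gt_eqF.
have c0 : 0 < Num.sqrt y by rewrite sqrtr_gt0.
have E x : 0 < x -> gkernel (- s) y (y / x) * (y / x ^+ 2) = y `^ (- s) * gkernel s y x.
  move=> x0; have xn0 : x != 0 by rewrite gt_eqF.
  have e : y / (y / x) = x by field; rewrite xn0 yn0.
  rewrite /gkernel e [y / x + x]addrC.
  rewrite mulrAC mulrA; congr (_ * _).
  rewrite powRM ?invr_ge0 ?(ltW y0) ?(ltW x0)//.
  rewrite -powR_inv1 ?(ltW x0)// -powRrM mulN1r opprB opprK.
  rewrite (_ : 1 + s = s - 1 + 2%:R); last by ring.
  rewrite (@powRD _ x) ?xn0 ?implybT// powR_mulrn ?(ltW x0)//.
  rewrite (@powRB _ y) ?yn0 ?implybT// powRr1 ?(ltW y0)//.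
  by field; rewrite xn0 yn0.
have int0 := integrable_gkernel (- s) y0.
have int1 := integrable_gkernel s y0.
have := @Rintegral_0y_inversion R (Num.sqrt y) c0 (gkernel (- s) y).
rewrite sqr_sqrtr ?(ltW y0)// => inv.
rewrite /gintegral -inv.
- transitivity (y `^ s * \int[mu]_(x in `]0, +oo[) (y `^ (- s) * gkernel s y x)).
    by rewrite RintegralZl// mulrA -powRD ?yn0 ?implybT// subrr powRr0 mul1r.
  congr (_ * _); apply: eq_Rintegral => x.
  by rewrite inE/= in_itv/= andbT => /E.
- by move=> x; exact: gkernel_continuous.
- exact: int0.
- apply: eq_integrable (integrable_0yZ (y `^ (- s)) int1) => //.
  by move=> x; rewrite inE/= in_itv/= andbT => /E /= ->.
Qed.

End gamma_function.

Section gamma_integral_regularity.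
Context {R : realType}.
Notation mu := (@lebesgue_measure R).
Implicit Types s t y : R.

Lemma gkernel_derive s y t : 0 < t ->
  is_derive y 1 (fun x => gkernel s x t) (- gkernel (s - 1) y t).
Proof.
move=> t0; have tn0 : t != 0 by rewrite gt_eqF.
apply: is_derive_eq; rewrite /gkernel /GRing.scale/=.
rewrite [t `^ (s - 1 - 1)]powRB ?tn0 ?implybT// powRr1 ?ltW//; ring.
Qed.

(** The derivative of the kernel in [y] decreases in absolute value, so on []y / 2, 2 y[] it is
    dominated by its size at [y / 2]. *)
Lemma gintegral_derive s y : 0 < y ->
  is_derive y 1 (gintegral s) (- gintegral (s - 1) y).
Proof.
move=> y0.
have Iy : `]y / 2, y * 2[%classic y by rewrite /= in_itv/=; lra.
have I0 x : `]y / 2, y * 2[%classic x -> 0 < x by rewrite /= in_itv/=; lra.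
pose dom t : R := if 0 < t then gkernel (s - 1) (y / 2) t else 0.
have d1E x t : 0 < t -> partial1of2 (gkernel s) x t = - gkernel (s - 1) x t.
  by move=> t0; rewrite partial1of2E; have [_ ->] := gkernel_derive s x t0.
have intf x : `]y / 2, y * 2[%classic x -> mu.-integrable `]0, +oo[ (EFin \o gkernel s x).
  by move=> /I0; exact: integrable_gkernel.
have derf x t : `]y / 2, y * 2[%classic x -> `]0, +oo[%classic t ->
    derivable (fun x => gkernel s x t) x 1.
  by move=> _; rewrite /= in_itv/= andbT => t0; have [] := gkernel_derive s x t0.
have dom_ge0 t : 0 <= dom t.
  by rewrite /dom; case: ifP => // _; exact: gkernel_ge0.
have int_dom : mu.-integrable `]0, +oo[ (EFin \o dom).
  have y20 : 0 < y / 2 by rewrite divr_gt0.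
  apply: eq_integrable (integrable_gkernel (s - 1) y20) => //.
  by move=> t; rewrite inE/= in_itv/= andbT /dom => ->.
have dom_ub x t : `]y / 2, y * 2[%classic x -> `]0, +oo[%classic t ->
    `|partial1of2 (gkernel s) x t| <= dom t.
  rewrite /= !in_itv/= andbT => /andP[yx _] t0.
  rewrite d1E// normrN ger0_norm ?gkernel_ge0// /dom t0.
  rewrite ler_wpM2l ?powR_ge0// ler_expR lerN2 lerD2l ler_pM2r ?invr_gt0//.
  exact: ltW.
have D := @derivable_under_integral R _ _ mu _ _ (measurable_itv _) y _ _ Iy
  intf derf dom dom_ge0 int_dom dom_ub.
split=> //; rewrite -derive1E.
have := @differentiation_under_integral R _ _ mu _ _ (measurable_itv _) y _ _ Iy
  intf derf dom dom_ge0 int_dom dom_ub.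
rewrite -/(gintegral s) => ->.
transitivity (\int[mu]_(t in `]0, +oo[) (-1 * gkernel (s - 1) y t)).
  apply: eq_Rintegral => t; rewrite inE/= in_itv/= andbT => t0.
  by rewrite d1E// mulN1r.
by rewrite RintegralZl ?mulN1r//; exact: integrable_gkernel.
Qed.

(** Serves the integer orders, where [besselK] is a limit in the order. For [x] within [1] of [s],
    the power [t ^ (x - 1)] lies below the sum of the powers for the orders [s - 1] and [s + 1]. *)
Lemma gintegral_continuous_order s y : 0 < y ->
  {for s, continuous (fun s => gintegral s y)}.
Proof.
move=> y0.
have intf x : `]s - 1, s + 1[%classic x -> mu.-integrable `]0, +oo[ (EFin \o gkernel x y).
  by move=> _; exact: integrable_gkernel.
have := @continuity_under_integral R _ _ mu (fun x => gkernel x y) `]0, +oo[%classic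
  (measurable_itv _) (s - 1) (s + 1) intf.
move=> /(_ _ (fun t => gkernel (s - 1) y t + gkernel (s + 1) y t) _ _ s).
apply.
- apply: aeW => t /=; rewrite in_itv/= andbT => t0 x _.
  apply: (@is_derive1_continuous R (fun x => gkernel x y t) x).
  rewrite /gkernel /powR gt_eqF//; exact: is_deriveM.
- by apply: integrable_0yD; exact: integrable_gkernel.
- move=> x; rewrite /= in_itv/= => /andP[x1 x2]; apply: aeW => t /=.
  rewrite in_itv/= andbT => t0.
  rewrite ger0_norm ?gkernel_ge0// /gkernel -mulrDl ler_wpM2r ?expR_ge0//.
  have [t1|t1] := leP 1 t.
    by apply: ler_wpDl; rewrite ?powR_ge0// ler_powR//; lra.
  by apply: ler_wpDr; rewrite ?powR_ge0// ger_powR ?t0 ?ltW//; lra.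
- by rewrite inE/= in_itv/=; lra.
Qed.

(** Replacing [y] by its absolute value extends the integral to a two-sided neighbourhood of [0],
    where continuity under the integral applies. *)
Lemma gintegral_cvg0 s : 0 < s -> gintegral s y @[y --> 0^'+] --> gintegral s 0.
Proof.
move=> s0.
have intf x : `]-1, 1[%classic x -> mu.-integrable `]0, +oo[ (EFin \o gkernel s `|x|).
  by move=> _; exact: integrable_gkernel_pos.
have := @continuity_under_integral R _ _ mu (fun x => gkernel s `|x|) `]0, +oo[%classic
  (measurable_itv _) (-1) 1 intf.
move=> /(_ _ (gkernel s 0) _ _ 0) cont.
have {}cont : {for 0, continuous (fun y => gintegral s `|y|)}.
  apply: cont.
  - apply: aeW => t /=; rewrite in_itv/= andbT => t0 x _.
    apply: (@continuous_comp _ _ _ (fun x : R => `|x|) (fun x => gkernel s x t)).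
      exact: norm_continuous.
    exact: (@is_derive1_continuous R _ _ _ (gkernel_derive s _ t0)).
  - exact: integrable_gkernel_pos.
  - move=> x _; apply: aeW => t /=; rewrite in_itv/= andbT => t0.
    rewrite ger0_norm ?gkernel_ge0// ler_wpM2l ?powR_ge0//.
    by rewrite ler_expR lerN2 lerD2l mul0r divr_ge0// ltW.
  - by rewrite inE/= in_itv/=; lra.
have : gintegral s `|y| @[y --> 0^'+] --> gintegral s `|0 : R|.
  by apply: cvg_at_right_filter; exact: cont.
rewrite normr0.
apply: cvg_trans; apply: near_eq_cvg; near=> y.
by rewrite gtr0_norm//; near: y; exact: nbhs_right_gt.
Unshelve. all: by end_near. Qed.

End gamma_integral_regularity.

(** * Cauchy's cosine integrals *)

Section cosine_moments.
Context {R : realType}.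
Notation mu := (@lebesgue_measure R).
Implicit Types (v t : R) (f F : R -> R).

Let quarter : set R := `[0, pi / 2]%classic.

Let Rintegral_quarter f F : (forall t, is_derive t 1 F (f t)) ->
  (forall t, {for t, continuous f}) ->
  \int[mu]_(t in quarter) f t = F (pi / 2) - F 0.
Proof.
move=> dF cf.
have cF t : {for t, continuous F} by exact: is_derive1_continuous (dF t).
rewrite /Rintegral (continuous_FTC2 (F := F))//.
- by rewrite divr_gt0// pi_gt0.
- by apply: continuous_in_subspaceT => t _; exact: cf.
- split; first by move=> t _; have [] := dF t.
  + by apply: cvg_at_right_filter; apply: cF.
  + by apply: cvg_at_left_filter; apply: cF.
- by move=> t _; rewrite derive1E; have [_ ->] := dF t.
Qed.

Let integrable_quarter f : (forall t, {for t, continuous f}) ->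
  mu.-integrable quarter (EFin \o f).
Proof.
move=> cf; apply: continuous_compact_integrable; first exact: segment_compact.
by apply: continuous_in_subspaceT => t _; exact: cf.
Qed.

(** Cauchy's integral, with classical value [pi (2 n)! / (2 ^ (2 n + 1) Gamma (n + 1 + v) Gamma (n +
    1 - v))]. It links the sine, at [n = 0], to a product of two [Gamma] values. *)
Definition cos_moment v n : R :=
  \int[mu]_(t in quarter) (cos (2 * v * t) * cos t ^+ (2 * n)).

Let dscale w t : is_derive t 1 (fun t => w * t) w.
Proof. by apply: is_derive_eq; rewrite /GRing.scale/= mulr1. Qed.

Let dcos w t : is_derive t 1 (fun t => cos (w * t)) (- sin (w * t) * w).
Proof. exact: (is_derive1_comp (is_derive_cos (w * t)) (dscale w t)). Qed.

Let dsin w t : is_derive t 1 (fun t => sin (w * t)) (cos (w * t) * w).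
Proof. exact: (is_derive1_comp (is_derive_sin (w * t)) (dscale w t)). Qed.

Let cos_moment_continuous v k t :
  {for t, continuous (fun t => cos (2 * v * t) * cos t ^+ k)}.
Proof.
have dc := dcos (2 * v) t; apply: cvgM; first exact: is_derive1_continuous dc.
elim: k => [|k IH]; first exact: cvg_cst.
by under eq_fun do rewrite exprS; rewrite exprS; apply: cvgM => //; exact: continuous_cos.
Qed.

(** The boundary terms of two integrations by parts: each contains a sine that vanishes at [0] and a
    power of [cos t] that vanishes at [pi / 2]. *)
Let cos_moment_primitive v m t :
  is_derive t 1 (fun t => 2 * v * (sin (2 * v * t) * cos t ^+ m.+2) -
    m.+2%:R * (cos (2 * v * t) * (sin t * cos t ^+ m.+1)))
  (m.+2%:R * (m.+2%:R - 1) * (cos (2 * v * t) * cos t ^+ m) -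
   (m.+2%:R ^+ 2 - (2 * v) ^+ 2) * (cos (2 * v * t) * cos t ^+ m.+2)).
Proof.
have dX k : is_derive t 1 (fun t => cos t ^+ k) (k%:R * cos t ^+ k.-1 * - sin t).
  have := is_deriveX k (is_derive_cos t); congr is_derive.
  by apply/funext => u; rewrite exprfctE.
have dS := is_deriveM (is_derive_sin t) (dX m.+1).
have d1 := is_deriveZ (2 * v) (is_deriveM (dsin (2 * v) t) (dX m.+2)).
have d2 := is_deriveZ m.+2%:R (is_deriveM (dcos (2 * v) t) dS).
refine (is_derive_eq (is_deriveB d1 d2) _).
rewrite /GRing.scale/= -[m.+2%:R]natr1.
have S2 : sin t * sin t = 1 - cos t * cos t by rewrite -!expr2 sin2cos2.
rewrite mulrfctE !exprS !expr0.
set S := sin t in S2 *; set C := cos t in S2 *; set X := C ^+ m.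
set s := sin _; set c := cos _; set N : R := m.+1%:R.
transitivity (2 * v * (2 * v) * c * C * C * X - (N + 1) * c * C * C * X +
  (N + 1) * N * c * X * (S * S)); first by ring.
by rewrite S2; ring.
Qed.

Lemma cos_moment_rec v n :
  (n.+1%:R ^+ 2 - v ^+ 2) * cos_moment v n.+1 =
  n.+1%:R * (n%:R + 2^-1) * cos_moment v n.
Proof.
pose N : R := (2 * n).+2%:R.
pose F t := 2 * v * (sin (2 * v * t) * cos t ^+ (2 * n).+2) -
  N * (cos (2 * v * t) * (sin t * cos t ^+ (2 * n).+1)).
pose f t := N * (N - 1) * (cos (2 * v * t) * cos t ^+ (2 * n)) -
   (N ^+ 2 - (2 * v) ^+ 2) * (cos (2 * v * t) * cos t ^+ (2 * n).+2).
have dF t : is_derive t 1 F (f t) by exact: cos_moment_primitive.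
have cf t : {for t, continuous f}.
  by apply: cvgB; apply: cvgMr; exact: cos_moment_continuous.
have := Rintegral_quarter dF cf.
rewrite /F mulr0 sin0 mul0r cos_pihalf !expr0n/= !(mulr0, mul0r, subr0).
have iq k : mu.-integrable quarter (EFin \o (fun t => cos (2 * v * t) * cos t ^+ k)).
  by apply: integrable_quarter => t; exact: cos_moment_continuous.
have mq : measurable quarter by exact: measurable_itv.
rewrite RintegralB//; last 2 first.
- exact: integrable_EFinZ (iq _).
- exact: integrable_EFinZ (iq _).
rewrite !RintegralZl//.
rewrite -/(cos_moment v n) (_ : (2 * n).+2 = (2 * n.+1)%N) -/(cos_moment v n.+1); last by rewrite mulnS.
have -> : N = 2 * n.+1%:R by rewrite -natrM mulnS.
rewrite -(natr1 n); nra.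
Qed.

Lemma cos_moment0 v : v != 0 -> cos_moment v 0 = sin (v * pi) / (2 * v).
Proof.
move=> v0; rewrite /cos_moment.
pose F t := (2 * v)^-1 * sin (2 * v * t).
have dF t : is_derive t 1 F (cos (2 * v * t) * cos t ^+ (2 * 0)).
  have ds := dsin (2 * v) t; apply: is_derive_eq; rewrite /GRing.scale/=.
  by rewrite muln0 expr0; field.
rewrite (Rintegral_quarter dF); last by move=> t; exact: cos_moment_continuous.
rewrite /F mulr0 sin0 mulr0 subr0 (_ : 2 * v * (pi / 2) = v * pi); last by field.
exact: mulrC.
Qed.

Lemma cos_moment0_0 : cos_moment 0 0 = pi / 2.
Proof.
rewrite /cos_moment (@eq_Rintegral _ _ _ _ _ (fun=> 1)); last first.
  by move=> t _; rewrite mulr0 mul0r cos0 expr0 mulr1.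
rewrite (@Rintegral_quarter _ (fun t => t)) ?subr0//.
by move=> t; exact: cst_continuous.
Qed.

Let ler_cos_pi : {in `[0, pi] &, {homo @cos R : x y /~ x <= y}}.
Proof.
move=> x y x0 y0; rewrite le_eqVlt => /predU1P[->//|xy].
by apply: ltW; rewrite ltr_cos.
Qed.

(** On [[0, pi / 2]], [2 cos t ^ 2 - 1 = cos (2 t) <= cos (2 v t) <= 1] because the cosine decreases
    on [[0, pi]]. *)
Lemma cos_moment_bounds v n : 0 < v < 1 ->
  2 * cos_moment 0 n.+1 - cos_moment 0 n <= cos_moment v n <= cos_moment 0 n.
Proof.
move=> /andP[v0 v1].
have iq w k : mu.-integrable quarter (EFin \o (fun t => cos (2 * w * t) * cos t ^+ k)).
  by apply: integrable_quarter => t; exact: cos_moment_continuous.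
have mq : measurable quarter by exact: measurable_itv.
have even_ge0 t k : 0 <= cos t ^+ (2 * k) by rewrite exprM exprn_ge0// sqr_ge0.
have cos00 t : cos (2 * 0 * t) = 1 by rewrite mulr0 mul0r cos0.
apply/andP; split; last first.
  apply: le_Rintegral => // t _.
  by rewrite ler_wpM2r// cos00 cos_le1.
rewrite /cos_moment -RintegralZl// -RintegralB//; last exact: integrable_EFinZ (iq _ _).
apply: le_Rintegral => //.
  apply: integrable_EFinB => //; apply: integrable_EFinZ => //.
move=> t; rewrite /quarter/= in_itv/= => /andP[t0 tpi].
rewrite cos00 !mul1r mulnS exprD mulrA -{2}[cos t ^+ (2 * n)]mul1r -mulrBl ler_wpM2r//.
have -> : 2 * cos t ^+ 2 - 1 = cos (2 * t) by rewrite [2 * t]mulr_natl cos_mulr2n mulr_natl.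
have vt0 : 0 <= v * t by rewrite mulr_ge0// ltW.
have vt : v * t <= t by rewrite ler_piMl// ltW.
by apply: ler_cos_pi; rewrite -?(mulrA 2 v) ?in_itv/=; lra.
Qed.

End cosine_moments.

(** * Reflection formula *)

Section gamma_reflection.
Context {R : realType}.
Notation mu := (@lebesgue_measure R).
Implicit Types (a v : R).

(** Young's inequality [(t / a) ^ v <= (1 - v) + v t / a], integrated against
    [t ^ (a - 1) exp (- t)]; the right-hand side collapses through [Gamma (a + 1) = a Gamma a]. *)
Lemma GammaD_le a v : 0 < a -> 0 < v < 1 -> Gamma (a + v) <= a `^ v * Gamma a.
Proof.
move=> a0 /andP[v0 v1].
have av0 : 0 < a + v by rewrite addr_gt0.
have a10 : 0 < a + 1 by rewrite addr_gt0.
have ia := integrable_gkernel_pos a0 (lexx 0).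
have ia1 := integrable_gkernel_pos a10 (lexx 0).
have -> : a `^ v * Gamma a = a `^ v * (1 - v) * Gamma a + a `^ v * (v / a) * Gamma (a + 1).
  by rewrite GammaS//; field; rewrite gt_eqF.
rewrite !Gamma_gintegral// /gintegral -!RintegralZl// -RintegralD//; last 2 first.
- exact: integrable_0yZ.
- exact: integrable_0yZ.
apply: le_Rintegral => //.
- exact: integrable_gkernel_pos.
- by apply: integrable_0yD; exact: integrable_0yZ.
move=> t /=; rewrite in_itv/= andbT => t0.
have tn0 : t != 0 by rewrite gt_eqF.
have an0 : a != 0 by rewrite gt_eqF.
rewrite /gkernel !mulrA -mulrDl ler_wpM2r ?expR_ge0//.
rewrite (_ : a + v - 1 = v + (a - 1)); last by ring.
rewrite (_ : a + 1 - 1 = 1 + (a - 1)); last by ring.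
rewrite !(@powRD _ t _ (a - 1)) ?tn0 ?implybT// powRr1 ?(ltW t0)// mulrA -mulrDl.
rewrite ler_wpM2r ?powR_ge0//.
have -> : t `^ v = a `^ v * (t / a) `^ v.
  by rewrite -powRM ?divr_ge0 ?(ltW a0) ?(ltW t0)//; congr (_ `^ _); field.
rewrite -!mulrA -mulrDr ler_wpM2l ?powR_ge0//.
have := @conjugate_powR R ((t / a) `^ v) 1 v^-1 (1 - v)^-1 (powR_ge0 _ _) ler01.
rewrite !invr_gt0 !invrK powR1 -powRrM mulfV ?gt_eqF// powRr1 ?divr_ge0 ?(ltW a0) ?(ltW t0)//.
rewrite mulr1 mul1r => h; rewrite (le_trans (h _ _ _))//; try lra.
Qed.

Lemma Gamma1 : Gamma 1 = 1 :> R.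
Proof.
rewrite Gamma_gintegral//.
pose F (t : R) := - expR (- t).
have kE (t : R) : 0 < t -> gkernel 1 0 t = expR (- t).
  by move=> t0; rewrite /gkernel subrr powRr0 mul1r mul0r addr0.
have dE (t : R) : is_derive t 1 F (expR (- t)).
  by apply: is_derive_eq; rewrite /GRing.scale/= ; ring.
have := @Rintegral_0y_derivative R 1 ltr01 (gkernel 1 0) F (-1) 0
  (integrable_gkernel_pos ltr01 (lexx 0)).
rewrite sub0r opprK; apply.
- by move=> t t0; rewrite kE//; exact: dE.
- by move=> t t0; exact: gkernel_continuous.
- have /cvg_at_right_filter := is_derive1_continuous (dE 0).
  by rewrite /F oppr0 expR0.
- by rewrite -oppr0; apply: cvgN; exact: cvgr_expR.
Qed.

Lemma cos_moment0_rec n :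
  cos_moment 0 n.+1 = (n%:R + 2^-1) / n.+1%:R * cos_moment (0 : R) n.
Proof.
have n0 : n.+1%:R != 0 :> R by rewrite pnatr_eq0.
apply: (mulfI (expf_neq0 2 n0)).
have := cos_moment_rec (0 : R) n; rewrite expr0n/= subr0 => ->.
by field.
Qed.

Lemma cos_moment_gt0 n : 0 < cos_moment (0 : R) n.
Proof.
elim: n => [|n IH]; first by rewrite cos_moment0_0 divr_gt0// pi_gt0.
by rewrite cos_moment0_rec mulr_gt0// divr_gt0.
Qed.

Let gamma_ratio v n := Gamma (n.+1%:R + v) * Gamma (n.+1%:R - v) / Gamma (n.+1%:R) ^+ 2.

Let gamma_ratioS v n : 0 < v < 1 ->
  n.+1%:R ^+ 2 * gamma_ratio v n.+1 = (n.+1%:R ^+ 2 - v ^+ 2) * gamma_ratio v n.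
Proof.
move=> /andP[v0 v1]; set m : R := n.+1%:R.
have m1 : 1 <= m by rewrite ler1n.
rewrite /gamma_ratio -(natr1 n.+1) -/m.
rewrite (_ : m + 1 + v = (m + v) + 1); last by ring.
rewrite (_ : m + 1 - v = (m - v) + 1); last by ring.
have mv : 0 < m - v by lra.
have mv' : 0 < m + v by lra.
have m0 : 0 < m by lra.
rewrite !GammaS//; field; rewrite !gt_eqF// Gamma_gt0//.
Qed.

(** Two uses of [GammaD_le] bound [Gamma (m + v)] and [Gamma (m - v)] above, two more starting from
    these arguments bound them below. In each product the exponents [v] and [1 - v] add up to
    [1]. *)
Let gamma_ratio_bounds v n : 0 < v < 1 ->
  n.+2%:R / n.+3%:R <= gamma_ratio v n.+1 <= n.+2%:R / n.+1%:R.
Proof.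
move=> /[dup] v01 /andP[v0 v1].
have v01' : 0 < 1 - v < 1 by lra.
rewrite /gamma_ratio; set m : R := n.+2%:R; set k : R := n.+1%:R.
have mE : m = k + 1 by rewrite /m -natr1.
have k1 : 1 <= k by rewrite ler1n.
have k0 : 0 < k by lra.
have m0 : 0 < m by lra.
have mv0 : 0 < m - v by lra.
have pow_sub (x : R) : 0 < x -> x `^ (1 - v) * x `^ v = x.
  by move=> x0; rewrite -powRD ?subrK ?powRr1 ?ltW// gt_eqF ?implybT.
have Gm := Gamma_gt0 m0.
have Gk := Gamma_gt0 k0.
have Gmv := Gamma_gt0 mv0.
have Gmv' : 0 < Gamma (m + v) by rewrite Gamma_gt0// addr_gt0.
have GmE : Gamma m = k * Gamma k by rewrite mE GammaS.
have u1 := GammaD_le m0 v01.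
have u2 := GammaD_le k0 v01'; rewrite (_ : k + (1 - v) = m - v) in u2; last by rewrite mE; ring.
have l1 : Gamma (m + 1) <= (m + 1) `^ (1 - v) * Gamma (m + v).
  have := GammaD_le (addr_gt0 m0 v0) v01'; rewrite (_ : m + v + (1 - v) = m + 1); last by ring.
  move=> /le_trans; apply; rewrite ler_wpM2r ?(ltW Gmv')//.
  by apply: ge0_ler_powR; rewrite ?nnegrE; lra.
have l2 : Gamma m <= (m + 1) `^ v * Gamma (m - v).
  have := GammaD_le mv0 v01; rewrite subrK => /le_trans; apply.
  rewrite ler_wpM2r ?(ltW Gmv)//.
  by apply: ge0_ler_powR; rewrite ?nnegrE; lra.
apply/andP; split.
  rewrite ler_pdivlMr ?exprn_gt0//.
  have -> : n.+3%:R = m + 1 :> R by rewrite /m natr1.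
  rewrite mulrAC ler_pdivrMr; last by lra.
  have := ler_pM (ltW (Gamma_gt0 (addr_gt0 m0 ltr01))) (ltW Gm) l1 l2.
  rewrite GammaS// [leRHS]mulrACA pow_sub; last by lra.
  by move=> h; rewrite expr2 mulrA [leRHS]mulrC.
rewrite ler_pdivrMr ?exprn_gt0//.
have := ler_pM (ltW Gmv') (ltW Gmv) u1 u2.
move=> /le_trans; apply.
have e1 : m `^ v = m / m `^ (1 - v).
  by rewrite -[X in X / _](pow_sub m m0); field; rewrite gt_eqF ?powR_gt0.
have kmv : k `^ (1 - v) <= m `^ (1 - v) by apply: ge0_ler_powR; rewrite ?nnegrE; lra.
rewrite e1.
have -> : m / m `^ (1 - v) * Gamma m * (k `^ (1 - v) * Gamma k) =
   (k `^ (1 - v) / m `^ (1 - v)) * (m / k * Gamma m ^+ 2).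
  by rewrite GmE; field; rewrite !gt_eqF// powR_gt0.
rewrite ler_piMl//.
  by apply: mulr_ge0; [apply: divr_ge0; exact: ltW|exact/exprn_ge0/ltW].
by rewrite ler_pdivrMr ?powR_gt0// mul1r.
Qed.

Lemma le0_harmonic (x C : R) : (forall n, x <= C / n.+1%:R) -> x <= 0.
Proof.
move=> h; have lim : C / n.+1%:R @[n --> \oo] --> (0 : R).
  by rewrite -[X in _ --> X](mulr0 C); apply: cvgMr; exact: cvg_harmonic.
by apply: (cvgr_to_ge lim); exact: nearW.
Qed.

(* [cos_moment v n / cos_moment 0 n] obeys the inverse recurrence of [gamma_ratio v n], and both
   tend to [1]; at [n = 0] their product is the reflection formula. *)
Lemma Gamma_reflection v : 0 < v < 1 ->
  Gamma v * Gamma (1 - v) * sin (v * pi) = pi.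
Proof.
move=> /[dup] v01 /andP[v0 v1].
pose p n := gamma_ratio v n * (cos_moment v n / cos_moment 0 n).
have c0 n : cos_moment 0 n != 0 :> R by rewrite gt_eqF// cos_moment_gt0.
have pS n : p n.+1 = p n.
  have n0 : n.+1%:R != 0 :> R by rewrite pnatr_eq0.
  have n1 : n.+1%:R ^+ 2 - v ^+ 2 != 0.
    have : (1 : R) <= n.+1%:R by rewrite ler1n.
    move=> h; rewrite gt_eqF//; nra.
  have e1 := gamma_ratioS n v01.
  have e2 := cos_moment_rec v n.
  have h0 : n%:R + 2^-1 != 0 :> R by rewrite gt_eqF// ltr_wpDl// invr_gt0.
  move: e1 e2 (c0 n) n0 n1 h0; rewrite /p cos_moment0_rec.
  move: (n.+1%:R ^+ 2 - v ^+ 2) => A; move: (n.+1%:R : R) (n%:R + 2^-1) => N h.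
  move: (gamma_ratio v n.+1) (cos_moment v n.+1) => g' c' e1 e2 cn N0 A0 h0.
  have -> : g' = A * gamma_ratio v n / N ^+ 2.
    by rewrite -e1 mulrC mulKf// expf_neq0.
  have -> : c' = N * h * cos_moment v n / A by rewrite -e2 mulrC mulKf.
  by field; rewrite h0 cn A0 N0.
have pE n : p n = p 0%N by elim: n => // n IH; rewrite pS.
have r_bounds n : n%:R / n.+1%:R <= cos_moment v n / cos_moment 0 n <= 1.
  have /andP[lb ub] := cos_moment_bounds n v01.
  have cn := cos_moment_gt0 n.
  apply/andP; split; last by rewrite [leLHS]mulrC ler_pdivrMl// mulr1.
  rewrite ler_pdivlMr// (le_trans _ lb)//.
  have n0 : n%:R + 1 != 0 :> R by rewrite natr1 pnatr_eq0.
  rewrite cos_moment0_rec -natr1 le_eqVlt; apply/orP; left; apply/eqP.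
  by field.
(* [p] is constant, while the bounds on its two factors give [1 - 2 / (n + 1) <= p n.+1 <= 1 + 1 /
   (n + 1)]. *)
have p1 : p 0%N = 1.
  apply/eqP; rewrite eq_le; apply/andP; split; rewrite -subr_le0.
    apply: (@le0_harmonic _ 1) => n; rewrite -(pE n.+1) lerBlDr /p.
    have /andP[_ g] := gamma_ratio_bounds n v01.
    have /andP[rl r] := r_bounds n.+1.
    have r0 := le_trans (divr_ge0 (ler0n R n.+1) (ler0n R n.+2)) rl.
    have g0 : 0 <= gamma_ratio v n.+1.
      have /andP[+ _] := gamma_ratio_bounds n v01; apply: le_trans.
      by rewrite divr_ge0.
    rewrite (le_trans (ler_pM g0 r0 g r))// mulr1 -natr1 mulrDl divff//.
    by rewrite addrC.
  apply: (@le0_harmonic _ 2) => n; rewrite -(pE n.+1) lerBlDr -lerBlDl /p.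
  have /andP[g _] := gamma_ratio_bounds n v01.
  have /andP[rl _] := r_bounds n.+1.
  have := ler_pM (divr_ge0 (ler0n R n.+2) (ler0n R n.+3)) (divr_ge0 (ler0n R n.+1) (ler0n R n.+2)) g rl.
  apply: le_trans.
  have -> : n.+2%:R / n.+3%:R * (n.+1%:R / n.+2%:R) = n.+1%:R / n.+3%:R :> R.
    by rewrite mulrC mulrA divfK// pnatr_eq0.
  have -> : n.+3%:R = n.+1%:R + 2 :> R by rewrite -natrD addn2.
  have n1 : (1 : R) <= n.+1%:R by rewrite ler1n.
  rewrite lerBlDr -subr_ge0.
  have -> : n.+1%:R / (n.+1%:R + 2) + 2 / n.+1%:R - 1 = 4 / (n.+1%:R * (n.+1%:R + 2)) :> R.
    by field; rewrite !gt_eqF//; lra.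
  by rewrite divr_ge0// mulr_ge0//; lra.
move: p1; rewrite /p /gamma_ratio Gamma1 cos_moment0_0 cos_moment0 ?gt_eqF//.
rewrite [1 + v]addrC GammaS// => e.
have pi0 : pi != 0 :> R by rewrite gt_eqF// pi_gt0.
have vn0 : v != 0 by rewrite gt_eqF.
have := congr1 (fun z => z * pi) e; rewrite mul1r => E; rewrite -[RHS]E.
move: (sin (v * pi)) pi0 => S; move: (pi : R) => c c0'; field.
by rewrite c0' vn0.
Qed.

End gamma_reflection.

(** * Modified Bessel functions *)

Section bessel_series.
Context {R : realType}.
Implicit Types (m x y : R) (k n : nat).

Definition bcoef m k : R := (k`!%:R * Gamma (k%:R + m + 1))^-1.

Let bcoefE m k : bcoef m k = k`!%:R^-1 * (Gamma (k%:R + m + 1))^-1.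
Proof. exact: invfM. Qed.

(* [besselB m] is the entire function with [I_m x = (x / 2) ^ m * besselB m (x ^ 2 / 4)]. *)
Definition besselB m y : R := limn (pseries (bcoef m) y).

(** By [1 / Gamma s = s / Gamma (s + 1)], the absolute values decrease once [s >= 1]; only finitely
    many terms come before. *)
Let invGamma_bounded m : exists C, forall k, `|(Gamma (k%:R + m + 1))^-1| <= C.
Proof.
pose k0 := Num.truncn `|m|; pose a k : R := `|(Gamma (k%:R + m + 1))^-1|.
have mk0 : - m <= k0.+1%:R.
  rewrite (le_trans (ler_norm _))// normrN.
  by have /andP[_ /ltW] := truncn_itv (normr_ge0 m).
have a_le k : a (k0.+1 + k)%N <= a k0.+1.
  elim: k => [|k IH]; first by rewrite addn0.
  apply: le_trans IH; rewrite addnS /a [leRHS](congr1 _ (invGammaE _)) normrM.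
  rewrite (_ : (k0.+1 + k).+1%:R + m + 1 = (k0.+1 + k)%:R + m + 1 + 1); last first.
    by rewrite -natr1; ring.
  rewrite ler_peMl// (le_trans _ (ler_norm _))// natrD.
  have : 0 <= k%:R :> R by []; lra.
exists (\sum_(0 <= i < k0.+2) a i) => k.
have [kk0|kk0] := ltnP k k0.+2.
  rewrite big_mkord (bigD1 (Ordinal kk0))//= lerDl.
  by apply: sumr_ge0 => i _; exact: normr_ge0.
rewrite big_nat_recr//= -[leLHS]add0r lerD//.
  by apply: sumr_ge0 => i _; exact: normr_ge0.
by have := a_le (k - k0.+1)%N; rewrite (subnKC (ltnW kk0)).
Qed.

Lemma is_cvg_besselB m y : cvgn (pseries (bcoef m) y).
Proof.
apply: normed_cvg; have [C hC] := invGamma_bounded m.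
have C0 : 0 <= C by apply: le_trans (hC 0%N).
apply: (@series_le_cvg _ _ (fun k => C * (`|y| ^+ k / k`!%:R))) => [k|k|k|] /=.
- exact: normr_ge0.
- by rewrite mulr_ge0// divr_ge0// exprn_ge0.
- rewrite normrM normrX /bcoef invfM normrM [`|k`!%:R^-1|]ger0_norm ?invr_ge0//.
  rewrite [leRHS](_ : _ = k`!%:R^-1 * C * `|y| ^+ k); last by ring.
  by rewrite ler_wpM2r ?exprn_ge0// ler_wpM2l// invr_ge0.
- rewrite (_ : series _ = (fun n => C * series (exp_coeff `|y|) n)); last first.
    by apply/funext => n; rewrite /series/= big_distrr.
  by apply: (cvgP (C * limn (series (exp_coeff `|y|)))); apply: cvgMr;
    exact: is_cvg_series_exp_coeff.
Qed.

Lemma pseries_diffs_bcoef m : pseries_diffs (bcoef m) = bcoef (m + 1).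
Proof.
apply/funext => k; rewrite /pseries_diffs /bcoef factS natrM -mulrA invfM mulVKf ?pnatr_eq0//.
by congr (_ * Gamma _)^-1; rewrite -natr1; ring.
Qed.

Lemma besselB_derive m y : is_derive y 1 (besselB m) (besselB (m + 1) y).
Proof.
rewrite /besselB -pseries_diffs_bcoef.
apply: (@pseries_snd_diffs _ (bcoef m) (`|y| + 1)).
- exact: is_cvg_besselB.
- rewrite pseries_diffs_bcoef; exact: is_cvg_besselB.
- rewrite !pseries_diffs_bcoef; exact: is_cvg_besselB.
- by rewrite [ltRHS]ger0_norm ?addr_ge0// ltrDl.
Qed.

(** Coefficientwise it is [1 / Gamma (k + m) = (k + m) / Gamma (k + m + 1)], where the factor [k]
    produces [y] times the derivative. It holds at all real [m], as [invGammaE] does. *)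
Lemma besselB_rec m y : besselB (m - 1) y = m * besselB m y + y * besselB (m + 1) y.
Proof.
have c1 := @is_cvg_besselB (m + 1) y; rewrite -pseries_diffs_bcoef in c1.
have := pseries_diffs_equiv c1; rewrite pseries_diffs_bcoef => c2.
apply: cvg_lim => //.
have : m * pseries (bcoef m) y n +
    y * series (fun i => i%:R * bcoef m i * y ^+ i.-1) n @[n --> \oo] -->
    m * besselB m y + y * besselB (m + 1) y.
  by apply: cvgD; apply: cvgMr => //; exact: is_cvg_besselB.
apply: cvg_trans; apply: near_eq_cvg; apply: nearW => n.
rewrite /pseries /series/= !big_distrr/= -big_split/=; apply: eq_bigr => k _.
have -> : bcoef (m - 1) k = (k%:R + m) * bcoef m k.
  rewrite !bcoefE (_ : k%:R + (m - 1) + 1 = k%:R + m); last by ring.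
  by rewrite invGammaE mulrCA.
case: k => [|k]; first by rewrite expr0; ring.
by rewrite /= exprS; ring.
Qed.

Lemma besselB0 m : besselB m 0 = (Gamma (m + 1))^-1.
Proof.
apply: cvg_lim => //; rewrite -cvg_shiftS.
apply: (@cvg_trans _ ((fun=> (Gamma (m + 1))^-1) @ \oo)); last exact: cvg_cst.
apply: near_eq_cvg; apply: nearW => n.
rewrite /pseries /series/= big_nat_recl//= big1 => [|i _]; last by rewrite exprS mul0r mulr0.
by rewrite expr0 mulr1 addr0 /bcoef fact0 mul1r add0r.
Qed.

Lemma besselB_gt0 m y : -1 < m -> 0 <= y -> 0 < besselB m y.
Proof.
move=> m1 y0; have G k : 0 < bcoef m k.
  rewrite invr_gt0 mulr_gt0 ?ltr0n ?fact_gt0// Gamma_gt0//.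
  by rewrite -addrA ltr_wpDl//; lra.
apply: (lt_le_trans (G 0%N)); apply: limr_ge; first exact: is_cvg_besselB.
near=> n; have n0 : (0 < n)%N by near: n; exact: nbhs_infty_gt.
rewrite -(prednK n0) /pseries /series/= big_nat_recl//= expr0 mulr1 lerDl.
by apply: sumr_ge0 => i _; rewrite mulr_ge0 ?exprn_ge0// ltW.
Unshelve. all: by end_near. Qed.

Lemma besselIE m x : 0 < x -> besselI m x = (x / 2) `^ m * besselB m (x ^+ 2 / 4).
Proof.
move=> x0; apply: cvg_lim => //.
have : (x / 2) `^ m * pseries (bcoef m) (x ^+ 2 / 4) n @[n --> \oo] -->
    (x / 2) `^ m * besselB m (x ^+ 2 / 4).
  by apply: cvgMr; exact: is_cvg_besselB.
apply: cvg_trans; apply: near_eq_cvg; apply: nearW => n.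
rewrite /pseries /series/= big_distrr/=; apply: eq_bigr => k _.
have x2 : 0 < x / 2 by rewrite divr_gt0.
have xn0 : x / 2 != 0 by rewrite gt_eqF.
rewrite powRD ?xn0 ?implybT// powR_mulrn ?(ltW x2)// /bcoef -mul2n exprM.
rewrite (_ : (x / 2) ^+ 2 = x ^+ 2 / 4); last by field.
by rewrite mulrA [(_ / 2) `^ _ * _]mulrC mulrAC [in RHS]mulrAC; ring.
Qed.

End bessel_series.

(** * Integral form of the second solution for orders in []0, 1[] *)

Section bessel_second_kind.
Context {R : realType}.
Implicit Types (v s y z : R).

Lemma gt0_powRD y r s : 0 < y -> y `^ (r + s) = y `^ r * y `^ s.
Proof. by move=> y0; rewrite powRD// (gt_eqF y0) implybT. Qed.

Lemma eq0_derive0_cvg0 (f : R -> R) : (forall x : R, 0 < x -> is_derive x 1 f 0) ->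
  f x @[x --> 0^'+] --> (0 : R) -> forall x, 0 < x -> f x = 0.
Proof.
move=> df f0 x x0.
have fcst e : 0 < e < x -> f e = f x.
  move=> /andP[e0 ex].
  have [] := @MVT R f (fun=> 0) e x ex.
  - by move=> t; rewrite in_itv/= => /andP[et _]; apply: df; exact: lt_trans et.
  - apply: continuous_in_subspaceT => t; rewrite inE/= in_itv/= => /andP[et _].
    exact: is_derive1_continuous (df t (lt_le_trans e0 et)).
  by move=> t _ /eqP; rewrite mul0r subr_eq0 => /eqP ->.
have fx : f e @[e --> 0^'+] --> f x.
  apply: (@cvg_trans _ ((fun=> f x) @ (0 : R)^'+)); last exact: cvg_cst.
  apply: near_eq_cvg; near=> e; rewrite fcst//; apply/andP; split.
    by near: e; exact: nbhs_right_gt.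
  by near: e; exact: nbhs_right_lt.
exact: (cvg_unique _ fx f0).
Unshelve. all: by end_near. Qed.

Lemma besselB_cvg0 s : besselB s y @[y --> 0^'+] --> (Gamma (s + 1))^-1.
Proof.
rewrite -besselB0; apply: cvg_at_right_filter.
exact: is_derive1_continuous (besselB_derive s 0).
Qed.

(** Inversion trades the order [v - 1] for [1 - v]. The orders [v] and [1 - v] thus form a closed
    system, and for [0 < v < 1] both have finite limits at [y = 0]. *)
Let gintegral_derive' v y : 0 < y ->
  is_derive y 1 (gintegral v) (- (y `^ (v - 1) * gintegral (1 - v) y)).
Proof.
move=> y0; rewrite -(opprB v 1) -gintegral_inv//; exact: gintegral_derive.
Qed.

(** [y ^ (v / 2) (I_(- v) - I_v)] at [2 sqrt y], the numerator of [K_v]. *)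
Definition bdiff v y : R := besselB (- v) y - y `^ v * besselB v y.

Let powR_besselB_derive v y : 0 < y ->
  is_derive y 1 (fun y => y `^ v * besselB v y) (y `^ (v - 1) * besselB (v - 1) y).
Proof.
move=> y0; have dP := is_derive1_powR v y0; have dB := besselB_derive v y.
apply: is_derive_eq; rewrite /GRing.scale/= besselB_rec.
have -> : y `^ v = y `^ (v - 1) * y.
  by rewrite -[X in _ * X]powRr1 ?ltW// -gt0_powRD// subrK.
ring.
Qed.

Let bdiff_derive v y : 0 < y ->
  is_derive y 1 (bdiff v) (- (y `^ (v - 1) * bdiff (1 - v) y)).
Proof.
move=> y0; have d1 := besselB_derive (- v) y; have d2 := powR_besselB_derive v y0.
apply: is_derive_eq; rewrite /bdiff !opprB (addrC (- v) 1) mulrBr mulrA -gt0_powRD//.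
by rewrite (_ : v - 1 + (1 - v) = 0) ?powRr0 ?mul1r ?opprB//; ring.
Qed.

Let bdiff_cvg0 v : 0 < v -> bdiff v y @[y --> 0^'+] --> (Gamma (1 - v))^-1.
Proof.
move=> v0; rewrite -[X in _ --> X]subr0; apply: cvgB.
  by rewrite addrC; exact: besselB_cvg0.
by rewrite -[X in _ --> X](mul0r (Gamma (v + 1))^-1); apply: cvgM;
  [exact: powR_cvg0|exact: besselB_cvg0].
Qed.

Lemma gintegral_besselB v y : 0 < v < 1 -> 0 < y ->
  gintegral v y = Gamma v * Gamma (1 - v) * bdiff v y.
Proof.
move=> /andP[v0 v1] y0; have v1' : 0 < 1 - v by rewrite subr_gt0.
set C := Gamma v * Gamma (1 - v).
have Gv := Gamma_gt0 v0; have Gv' := Gamma_gt0 v1'.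
(* [(D, N)] and [(p, q)] solve the same linear system, so their Wronskian is constant, hence
   [0] by the limits at [0]; the same then holds for the derivative of [D / p]. *)
pose D y := gintegral v y - C * bdiff v y.
pose N y := gintegral (1 - v) y - C * bdiff (1 - v) y.
pose p y := besselB (- v) y.
pose q y := - (y `^ (1 - v) * besselB (1 - v) y).
have dD (x : R) : 0 < x -> is_derive x 1 D (- (x `^ (v - 1) * N x)).
  move=> x0; have d1 := gintegral_derive' v x0; have d2 := bdiff_derive v x0.
  by apply: is_derive_eq; rewrite /N /GRing.scale/=; ring.
have dN (x : R) : 0 < x -> is_derive x 1 N (- (x `^ (- v) * D x)).
  move=> x0; have d1 := gintegral_derive' (1 - v) x0.
  have d2 := bdiff_derive (1 - v) x0.
  apply: is_derive_eq; rewrite /D /GRing.scale/=.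
  rewrite (_ : 1 - v - 1 = - v); last by ring.
  by rewrite (_ : 1 - (1 - v) = v); ring.
have dp (x : R) : 0 < x -> is_derive x 1 p (- (x `^ (v - 1) * q x)).
  move=> x0; have d1 := besselB_derive (- v) x.
  apply: is_derive_eq; rewrite /q mulrN opprK mulrA -gt0_powRD//.
  by rewrite (_ : v - 1 + (1 - v) = 0) ?powRr0 ?mul1r 1?addrC//; ring.
have dq (x : R) : 0 < x -> is_derive x 1 q (- (x `^ (- v) * p x)).
  move=> x0; have d1 := powR_besselB_derive (1 - v) x0.
  apply: is_derive_eq; rewrite /p.
  by rewrite (_ : 1 - v - 1 = - v)//; ring.
have p_gt0 (x : R) : 0 < x -> 0 < p x by move=> x0; apply: besselB_gt0; [lra|exact: ltW].
(* The limit at [0] dictates [C]: the integral and [C * bdiff v] both tend to [Gamma v]. *)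
have D0 : D x @[x --> 0^'+] --> (0 : R).
  rewrite [X in _ --> X](_ : _ = Gamma v - C * (Gamma (1 - v))^-1); last first.
    by rewrite /C mulfK ?subrr// gt_eqF.
  apply: cvgB; first by rewrite Gamma_gintegral//; exact: gintegral_cvg0.
  by apply: cvgMr; exact: bdiff_cvg0.
have N0 : N x @[x --> 0^'+] --> (0 : R).
  rewrite [X in _ --> X](_ : _ = Gamma (1 - v) - C * (Gamma (1 - (1 - v)))^-1); last first.
    by rewrite (_ : 1 - (1 - v) = v) /C; [field; rewrite gt_eqF|ring].
  apply: cvgB; first by rewrite Gamma_gintegral//; exact: gintegral_cvg0.
  by apply: cvgMr; exact: bdiff_cvg0.
have p0 : p x @[x --> 0^'+] --> (Gamma (1 - v))^-1.
  by rewrite addrC; exact: besselB_cvg0.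
have q0 : q x @[x --> 0^'+] --> (0 : R).
  rewrite -[X in _ --> X]oppr0; apply: cvgN.
  by rewrite -[X in _ --> X](mul0r (Gamma (1 - v + 1))^-1); apply: cvgM;
    [exact: powR_cvg0|exact: besselB_cvg0].
have W0 (x : R) : 0 < x -> D x * q x - N x * p x = 0.
  apply: (@eq0_derive0_cvg0 (fun x => D x * q x - N x * p x)).
    move=> t t0; have d1 := dD t t0; have d2 := dN t t0.
    have d3 := dp t t0; have d4 := dq t t0.
    by apply: is_derive_eq; rewrite /GRing.scale/=; ring.
  rewrite [X in _ --> X](_ : _ = 0 * 0 - 0 * (Gamma (1 - v))^-1); last by ring.
  by apply: cvgB; apply: cvgM.
have Dp (x : R) : 0 < x -> D x * (p x)^-1 = 0.
  apply: (@eq0_derive0_cvg0 (fun x => D x * (p x)^-1)).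
    move=> t t0; have pt0 : p t != 0 by rewrite gt_eqF ?p_gt0.
    have d1 := dD t t0; have d3 := dp t t0; have d5 := is_derive1_inv pt0.
    apply: is_derive_eq; rewrite /GRing.scale/=.
    transitivity (t `^ (v - 1) * (p t ^+ 2)^-1 * (D t * q t - N t * p t)); first by field.
    by rewrite W0// mulr0.
  rewrite -[X in _ --> X](mul0r ((Gamma (1 - v))^-1)^-1); apply: cvgM => //.
  by apply: cvgV => //; rewrite invr_neq0// gt_eqF.
have := Dp y y0 => /eqP; rewrite mulf_eq0 invr_eq0 (gt_eqF (p_gt0 y y0)) orbF.
by rewrite subr_eq0 => /eqP.
Qed.

End bessel_second_kind.

(** * Extension to all positive orders *)

Section bessel_second_kind_integral.
Context {R : realType}.
Implicit Types (r v s y z : R).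

(** Kept free of division by the sine, the relation makes sense at integer orders, so the recurrence
    in the order can pass through them. *)
Let gintegral_sin s y := sin (s * pi) * gintegral s y = pi * bdiff s y.

Let gintegral_sin_01 v y : 0 < v < 1 -> 0 < y -> gintegral_sin v y.
Proof.
move=> v01 y0; rewrite /gintegral_sin gintegral_besselB// mulrA; congr (_ * _).
by rewrite mulrC Gamma_reflection.
Qed.

Let gintegral_sin_N v y : 0 < y -> gintegral_sin v y -> gintegral_sin (- v) y.
Proof.
move=> y0; rewrite /gintegral_sin (gintegral_inv (- v))// opprK mulNr sinN => h.
rewrite mulNr mulrCA h /bdiff opprK.
have e : y `^ (- v) * y `^ v = 1 by rewrite -gt0_powRD// addNr powRr0.
transitivity (pi * (y `^ (- v) * y `^ v * besselB v y - y `^ (- v) * besselB (- v) y)).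
  by ring.
by rewrite e mul1r.
Qed.

Let bdiff_rec s y : 0 < y -> bdiff (s + 1) y = y * bdiff (s - 1) y - s * bdiff s y.
Proof.
move=> y0; rewrite /bdiff.
have B1 := besselB_rec (- s) y; have B2 := besselB_rec s y.
rewrite (_ : - (s + 1) = - s - 1); last by ring.
rewrite (_ : - (s - 1) = - s + 1); last by ring.
have -> : y `^ s = y * y `^ (s - 1).
  by rewrite -[X in X * _]powRr1 ?ltW// -gt0_powRD// addrCA subrr addr0.
rewrite (_ : y `^ (s + 1) = y * y * y `^ (s - 1)); last first.
  rewrite (_ : s + 1 = s - 1 + 1 + 1); last by ring.
  by rewrite !gt0_powRD// powRr1 ?ltW//; ring.
by rewrite B1 B2; ring.
Qed.

Let sinD1pi s : sin ((s + 1) * pi) = - sin (s * pi).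
Proof. by rewrite (mulrDl s 1 pi) mul1r sinDpi. Qed.

(** The recurrences of [gintegral] and [bdiff] differ only by the sign of the term in [s], which the
    sign change of [sin (s pi)] under [s -> s + 1] absorbs. *)
Let gintegral_sin_rec s y : 0 < y -> gintegral_sin (s - 1) y -> gintegral_sin s y ->
  gintegral_sin (s + 1) y.
Proof.
move=> y0; rewrite /gintegral_sin gintegral_rec// sinD1pi bdiff_rec//.
have := sinD1pi (s - 1); rewrite subrK.
move: (sin (s * pi)) (sin ((s - 1) * pi)) => S S'.
move: (pi : R) => p -> h1 h2.
transitivity (y * (S' * gintegral (s - 1) y) - s * (- S' * gintegral s y)); first by ring.
by rewrite h1 h2; ring.
Qed.

Lemma gintegral_sin_bdiff s y : 0 < s -> 0 < y ->
  sin (s * pi) * gintegral s y = pi * bdiff s y.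
Proof.
move=> s0 y0.
pose n := Num.truncn s; have /andP[ns sn] := truncn_itv (ltW s0).
pose r := s - n%:R.
have r0 : 0 <= r by rewrite subr_ge0.
have r1 : r < 1 by rewrite ltrBlDl natr1.
(* A three-term recurrence needs two starting orders. Order [r - 1] comes from [1 - r] by symmetry;
   for [r = 0] both sides vanish, by [B_(-1) y = y B_1 y] at the order [-1]. *)
have base : gintegral_sin (r - 1) y /\ gintegral_sin r y.
  move: r0; rewrite le_eqVlt => /predU1P[r00|r0].
    rewrite -r00 sub0r; split; last first.
      by rewrite /gintegral_sin /bdiff mul0r sin0 mul0r oppr0 powRr0 mul1r subrr mulr0.
    apply: gintegral_sin_N => //; rewrite /gintegral_sin mul1r sinpi mul0r /bdiff.
    have := besselB_rec 0 y; rewrite sub0r mul0r !add0r => ->.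
    by rewrite powRr1 ?ltW// subrr mulr0.
  split; last by apply: gintegral_sin_01 => //; rewrite r0.
  rewrite -opprB; apply: gintegral_sin_N => //; apply: gintegral_sin_01 => //.
  by rewrite subr_gt0 r1 gtrBl.
suff H k : gintegral_sin (r + k%:R - 1) y /\ gintegral_sin (r + k%:R) y.
  by have [_] := H n; rewrite /gintegral_sin subrK.
elim: k => [|k [IH1 IH2]]; first by rewrite addr0.
rewrite -natr1 addrA addrK; split=> //; exact: gintegral_sin_rec.
Qed.

(** Away from the integers this is [gintegral_sin_bdiff] divided by the sine. At an integer the
    right-hand side is continuous in the order, hence equal to the defining limit. *)
Lemma besselKE nu z : 0 < nu -> 0 < z ->
  besselK nu z = 2^-1 * (z / 2) `^ (- nu) * gintegral nu (z ^+ 2 / 4).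
Proof.
move=> nu0 z0; set y := z ^+ 2 / 4; have y0 : 0 < y by rewrite divr_gt0 ?exprn_gt0.
have z20 : 0 < z / 2 by rewrite divr_gt0.
have yE : y = (z / 2) ^+ 2 by rewrite /y; field.
pose K s := 2^-1 * (z / 2) `^ (- s) * gintegral s y.
have nonintE s : 0 < s -> sin (s * pi) != 0 -> besselK_nonint s z = K s.
  move=> s0 sin0; rewrite /besselK_nonint !besselIE// -/y /K.
  have -> : (z / 2) `^ s = (z / 2) `^ (- s) * y `^ s.
    rewrite yE -powR_mulrn ?(ltW z20)// -powRrM -gt0_powRD//; congr (_ `^ _); ring.
  have := gintegral_sin_bdiff s0 y0; rewrite /bdiff.
  move: (sin (s * pi)) sin0 => S S0; move: (pi : R) => p h.
  have -> : gintegral s y = p * (besselB (- s) y - y `^ s * besselB s y) / S.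
    by rewrite -h mulrC mulKf.
  by field.
have sin_neq0 s : 0 < s -> s \isn't a Num.int -> sin (s * pi) != 0.
  move=> s0 sint.
  pose n := Num.truncn s; have /andP[ns sn] := truncn_itv (ltW s0).
  have rn0 : s - n%:R != 0.
    apply: contra sint; rewrite subr_eq0 => /eqP ->; exact: rpred_nat.
  have r0 : 0 < s - n%:R by rewrite lt_neqAle eq_sym rn0 subr_ge0.
  have r1 : s - n%:R < 1 by rewrite ltrBlDl natr1.
  suff H k : sin ((s - n%:R + k%:R) * pi) != 0 by have := H n; rewrite subrK.
  elim: k => [|k IH]; last by rewrite -natr1 addrA sinD1pi oppr_eq0.
  rewrite addr0 gt_eqF// sin_gt0_pi// mulr_gt0 ?pi_gt0//=.
  by rewrite -[ltRHS]mul1r ltr_pM2r// pi_gt0.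
rewrite /besselK; case: ifPn => [nuint|nuint]; last by rewrite nonintE// sin_neq0.
apply: cvg_lim => //.
have Kcont : {for nu, continuous K}.
  apply: cvgM; last exact: gintegral_continuous_order.
  apply: cvgMr; apply: (@is_derive1_continuous R (fun s => (z / 2) `^ (- s)) nu).
  rewrite /powR gt_eqF//; exact: is_derive1_comp.
have : K s @[s --> nu^'] --> K nu by apply: cvg_within_filter; exact: Kcont.
apply: cvg_trans; apply: near_eq_cvg; near=> s.
(* Radius [1] keeps other integers out of the punctured ball, and radius [nu] keeps [s] positive. *)
have sball : (ball nu (Num.min 1 nu) `\ nu) s.
  by near: s; apply: dnbhs_ball; rewrite lt_min ltr01.
move: sball => []; rewrite -ball_normE/= lt_min => /andP[s1 snu0] snu.
have s0 : 0 < s by move: snu0; rewrite ltr_distl; lra.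
rewrite nonintE// sin_neq0//; apply/negP => /intrP[k sk].
move: nuint => /intrP[l nul]; apply: snu; rewrite sk nul; congr (_%:~R).
move: s1; rewrite sk nul -intrB -intr_norm -[1]/(1%:~R) ltr_int.
by rewrite -[ltRHS]add0r ltzD1 normr_le0 subr_eq0 => /eqP.
Unshelve. all: by end_near. Qed.

End bessel_second_kind_integral.

(** * Logarithms of the two factors *)

Lemma cvg_at_right0 (R : realType) (T : Type) (F : set_system T) (FF : Filter F)
    (h : T -> R) :
  h t @[t --> F] --> (0 : R) -> (\forall t \near F, 0 < h t) -> h t @[t --> F] --> 0^'+.
Proof.
by move=> h0 h_gt0 A /h0; rewrite /= /fmap; apply: filterS2 h_gt0 => t ht /(_ ht).
Qed.

Section log_monotonicity.
Context {R : realType}.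
Implicit Types (n : nat) (a b c d nu m s t x : R).

Lemma is_derive1_expRM w t : is_derive t 1 (fun t => expR (w * t)) (w * expR (w * t)).
Proof.
have dw : is_derive t 1 (fun t => w * t) w.
  by apply: is_derive_eq; rewrite /GRing.scale/= mulr1.
have := is_derive1_comp (is_derive_expR (w * t)) dw.
by rewrite mulrC.
Qed.

Lemma is_derive1_expRMr w x t : is_derive t 1 (fun t => expR (w * t) * x) (w * (expR (w * t) * x)).
Proof.
have de := is_derive1_expRM w t; apply: is_derive_eq; rewrite /GRing.scale/=; ring.
Qed.

Lemma cvg_expRM_Ny w : 0 < w -> expR (w * t) @[t --> -oo] --> (0 : R).
Proof.
move=> w0; apply/cvgrPdist_le => e e0; near=> t.
rewrite sub0r normrN ger0_norm ?expR_ge0// -[leRHS](@lnK _ e) ?posrE// ler_expR.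
by rewrite mulrC -ler_pdivlMr.
Unshelve. all: by end_near. Qed.

(* Sturm-Liouville form of [gintegral nu (r * x)], in the variable [t = - ln r]. *)
Let fK nu t x := gintegral nu (expR (-1 * t) * x).
Let EK nu t x := x * (expR ((nu - 1) * t) * gintegral (nu - 1) (expR (-1 * t) * x)).

Let fK_derive nu t x : 0 < x -> is_derive t 1 (fK nu ^~ x) (expR (- nu * t) * EK nu t x).
Proof.
move=> x0; have y0 : 0 < expR (-1 * t) * x by rewrite mulr_gt0 ?expR_gt0.
have dc := is_derive1_comp (g := fun t => expR (-1 * t) * x) (gintegral_derive nu y0) (is_derive1_expRMr (-1) x t).
apply: (is_derive_eq dc); rewrite /EK.
rewrite (_ : -1 * t = - nu * t + (nu - 1) * t) ?expRD; last by ring.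
ring.
Qed.

Let EK_derive nu t x : 0 < x ->
  is_derive t 1 (EK nu ^~ x) (x * expR ((nu - 1) * t) * fK nu t x).
Proof.
move=> x0; have y0 : 0 < expR (-1 * t) * x by rewrite mulr_gt0 ?expR_gt0.
have d1 := is_derive1_comp (g := fun t => expR (-1 * t) * x)
  (gintegral_derive (nu - 1) y0) (is_derive1_expRMr (-1) x t).
have d2 := is_derive1_expRM (nu - 1) t.
have d3 := is_deriveM d2 d1.
apply: (is_derive_eq (is_deriveZ x d3)).
rewrite /fK -[in RHS](subrK 1 nu) gintegral_rec// /GRing.scale/=.
rewrite subrK; ring.
Qed.

Let EK_cvg0 nu x y : 0 < nu -> 0 < x -> 0 < y ->
  EK nu t x * fK nu t y @[t --> -oo] --> (0 : R).
Proof.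
move=> nu0 x0 y0.
(* [gintegral_le] with [k = 0] gains a factor [exp t] from each integral, so the exponent is
   [(nu - 1) + 1 + 1 = nu + 1 > 0]; the factor [x] cancels. *)
pose C := gintegral (nu - 1 + 1%:R) 0 * (1 / y * gintegral (nu + 1%:R) 0).
apply: (@squeeze_cvgr _ _ _ _ (cst 0) (fun t => C * expR ((nu + 1) * t))).
- near=> t; have e0 := expR_gt0 (-1 * t).
  have ex0 : 0 < expR (-1 * t) * x by rewrite mulr_gt0.
  have ey0 : 0 < expR (-1 * t) * y by rewrite mulr_gt0.
  rewrite /EK /fK !mulr_ge0 ?gintegral_ge0 ?expR_ge0 ?(ltW x0)//=.
  have nu1 : 0 < nu - 1 + 1%:R by rewrite subrK.
  have nu2 : 0 < nu + 1%:R by rewrite addr_gt0.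
  have h1 := gintegral_le (k := 0) ex0 nu1.
  have h2 := gintegral_le (k := 0) ey0 nu2.
  apply: (@le_trans _ _ (x * (expR ((nu - 1) * t) *
    (1`!%:R / (expR (-1 * t) * x) ^+ 1 * gintegral (nu - 1 + 1%:R) 0)) *
    (1`!%:R / (expR (-1 * t) * y) ^+ 1 * gintegral (nu + 1%:R) 0))).
    apply: ler_pM => //; rewrite ?mulr_ge0 ?gintegral_ge0 ?expR_ge0 ?(ltW x0)//.
    by rewrite ler_pM2l// ler_pM2l// expR_gt0.
  rewrite /C (_ : (nu + 1) * t = (nu - 1) * t - (-1 * t) - (-1 * t)); last by ring.
  rewrite !expRD !(expRN (-1 * t)) !expr1 le_eqVlt; apply/orP; left; apply/eqP.
  rewrite (_ : (1`!)%N = 1%N)//; field.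
  by rewrite !gt_eqF.
- exact: cvg_cst.
- rewrite -[X in _ --> X](mulr0 C); apply: cvgMr; apply: cvg_expRM_Ny.
  by rewrite addr_gt0.
Unshelve. all: by end_near. Qed.

(** The Sturm-Liouville increment runs from [t = - ln c] to [b]. As [b] tends to [+oo] the argument
    [exp (- b) x] tends to [0], where the dependence on [x] disappears. *)
Lemma ln_gintegral_CMn n nu c d : 0 < nu -> 0 < c -> 0 < d ->
  CMn n (fun x => ln (gintegral nu (c * x)) - ln (gintegral nu (c * (x + d)))).
Proof.
move=> nu0 c0 d0.
have f_gt0 t x : 0 < x -> 0 < fK nu t x.
  by move=> x0; rewrite gintegral_gt0 ?mulr_gt0 ?expR_gt0// ltW ?mulr_gt0 ?expR_gt0.
have SL := @sturm_liouville_ln R (fun t => expR (- nu * t)) (fun t => expR ((nu - 1) * t))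
  (fK nu) (EK nu) (fun t => expR_ge0 _) (fun t => expR_ge0 _) f_gt0
  (fun t x => @fK_derive nu t x) (fun t x => @EK_derive nu t x)
  (fun x y => @EK_cvg0 nu x y nu0) n (- ln c).
have fKc x : fK nu (- ln c) x = gintegral nu (c * x).
  by rewrite /fK mulN1r opprK lnK.
apply: (@CMn_cvg _ n _ +oo%R _ (fun b x => (ln (fK nu b (x + d)) - ln (fK nu b x)) -
                  (ln (fK nu (- ln c) (x + d)) - ln (fK nu (- ln c) x)))).
  by near=> b; apply: SL => //; near: b; exact: nbhs_pinfty_ge (num_real _).
move=> x x0; rewrite !fKc.
have lnf y : 0 < y -> ln (fK nu b y) @[b --> +oo] --> ln (gintegral nu 0).
  move=> y0; have g0 : 0 < gintegral nu 0 by rewrite gintegral_gt0 ?nu0 ?orbT.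
  apply: (@continuous_cvg _ _ _ _ _ (fK nu ^~ y) (@ln R)); first exact: continuous_ln.
  apply: (cvg_comp _ _ _ (gintegral_cvg0 nu0)).
  apply: cvg_at_right0; last first.
    by apply: nearW => b; rewrite mulr_gt0 ?expR_gt0.
  rewrite -[X in _ --> X](mul0r y); apply: cvgMl.
  by under eq_cvg do rewrite mulN1r; exact: cvgr_expR.
have shift_lim (h : R -> R) (l u v : R) :
    h b @[b --> +oo] --> (l - l) - (v - u) -> h b @[b --> +oo] --> u - v.
  by rewrite subrr sub0r opprB.
apply: (shift_lim _ (ln (gintegral nu 0))); apply: cvgB; last exact: cvg_cst.
by apply: cvgB; apply: lnf => //; rewrite addr_gt0.
Unshelve. all: by end_near. Qed.

End log_monotonicity.

(** * Ratios of [besselB] at two scales *)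

Section bessel_first_kind_monotonicity.
Context {R : realType}.
Implicit Types (n : nat) (a b c d mu m s t x : R).

(** Sturm-Liouville form of [besselB mu (r * x)], in the variable [t = ln r]. *)
Let fI mu t x := besselB mu (expR (1 * t) * x).
Let EI mu t x := x * (expR ((mu + 1) * t) * besselB (mu + 1) (expR (1 * t) * x)).

Let fI_derive mu t x : is_derive t 1 (fI mu ^~ x) (expR (- mu * t) * EI mu t x).
Proof.
have dc := is_derive1_comp (g := fun t => expR (1 * t) * x)
  (besselB_derive mu (expR (1 * t) * x)) (is_derive1_expRMr 1 x t).
apply: (is_derive_eq dc); rewrite /EI.
rewrite (_ : 1 * t = - mu * t + (mu + 1) * t) ?expRD; last by ring.
ring.
Qed.

Let EI_derive mu t x :
  is_derive t 1 (EI mu ^~ x) (x * expR ((mu + 1) * t) * fI mu t x).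
Proof.
have d1 := is_derive1_comp (g := fun t => expR (1 * t) * x)
  (besselB_derive (mu + 1) (expR (1 * t) * x)) (is_derive1_expRMr 1 x t).
have d2 := is_derive1_expRM (mu + 1) t.
have d3 := is_deriveM d2 d1.
apply: (is_derive_eq (is_deriveZ x d3)).
have := besselB_rec (mu + 1) (expR (1 * t) * x); rewrite addrK => rec.
rewrite /fI rec /GRing.scale/=; ring.
Qed.

Let besselB_expR_cvg m x : besselB m (expR (1 * t) * x) @[t --> -oo] --> besselB m 0.
Proof.
apply: (@continuous_cvg _ _ _ _ _ (fun t => expR (1 * t) * x) (besselB m)).
  exact: is_derive1_continuous (besselB_derive m 0).
by rewrite -[X in _ --> X](mul0r x); apply: cvgMl; exact: cvg_expRM_Ny.
Qed.

Let EI_cvg0 mu x y : -1 < mu -> EI mu t x * fI mu t y @[t --> -oo] --> (0 : R).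
Proof.
move=> mu1; rewrite -[X in _ --> X](mul0r (besselB mu 0)).
apply: cvgM; last exact: besselB_expR_cvg.
rewrite -[X in _ --> X](mulr0 x); apply: cvgMr.
rewrite -[X in _ --> X](mul0r (besselB (mu + 1) 0)).
by apply: cvgM; [apply: cvg_expRM_Ny; lra|exact: besselB_expR_cvg].
Qed.

Lemma besselB_ratio_CMn n mu a b : -1 < mu -> 0 < a -> a <= b ->
  CMn n (fun x => besselB mu (a * x) / besselB mu (b * x)).
Proof.
move=> mu1 a0 ab; have b0 := lt_le_trans a0 ab.
have f_gt0 t x : 0 < x -> 0 < fI mu t x.
  by move=> x0; rewrite besselB_gt0// mulr_ge0 ?expR_ge0// ltW.
have SL := @sturm_liouville_ratio R (fun t => expR (- mu * t)) (fun t => expR ((mu + 1) * t))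
  (fI mu) (EI mu) (fun t => expR_ge0 _) (fun t => expR_ge0 _) f_gt0
  (fun t x _ => @fI_derive mu t x) (fun t x _ => @EI_derive mu t x)
  (fun x y _ _ => @EI_cvg0 mu x y mu1) n (ln a) (ln b).
by move: SL; rewrite ler_ln ?posrE// /fI !mul1r !lnK ?posrE//; apply.
Qed.

Lemma expR_sqrt_CMn n t : 0 <= t -> CMn n (fun x => expR (- (t * Num.sqrt x))).
Proof.
move=> t0; apply: CMnS.
apply: CMn_expRN => d d0.
apply: (@CMn_ext _ _ (fun x => t * (Num.sqrt (x + d) - Num.sqrt x))).
  by move=> x _; rewrite mulrBr.
by apply: CMnZ => //; exact: CMn_sqrt.
Qed.

End bessel_first_kind_monotonicity.

(** * Logarithm of the exponentially damped [besselB] *)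

Section bessel_first_kind_log.
Context {R : realType}.
Variable mu : R.
Hypothesis mu_gt : 1 / 2 < mu.
Implicit Types (n : nat) (a b c d m s t x : R).

Let mu_gtN1 : -1 < mu.
Proof. by move: mu_gt; lra. Qed.

Let c := mu + 1 / 2.
Let A m s x := besselB m (s ^+ 2 / 4 * x).
Let w s := s `^ (c - 1).
(** The [v] of the overview with [s ^ (c - 1)] factored out, where [u s = w s * s * A mu s x]; the
    limit at [s = 0] becomes visible. *)
Let v s x := w s * (c * A mu s x + s ^+ 2 * (x / 2) * A (mu + 1) s x
                    - Num.sqrt x * (s * A mu s x)).

Let A_derive m s x : is_derive s 1 (fun s => A m s x) (s / 2 * x * A (m + 1) s x).
Proof.
have ds : is_derive s 1 (fun s => s ^+ 2 / 4 * x) (s / 2 * x).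
  by apply: is_derive_eq; rewrite /GRing.scale/=; field.
have := is_derive1_comp (g := fun s => s ^+ 2 / 4 * x) (besselB_derive m (s ^+ 2 / 4 * x)) ds.
by rewrite mulrC.
Qed.

Let A_gt0 s x : 0 < x -> 0 < A mu s x.
Proof. by move=> x0; rewrite besselB_gt0// mulr_ge0 ?divr_ge0 ?sqr_ge0// ltW. Qed.

Let w_derive s : 0 < s -> is_derive s 1 w ((c - 1) * (w s / s)).
Proof.
move=> s0; have := is_derive1_powR (c - 1) s0.
by rewrite [s `^ (c - 1 - 1)]powRB ?(gt_eqF s0) ?implybT// powRr1 ?ltW.
Qed.

Let A_rec s x : A mu s x = (mu + 1) * A (mu + 1) s x + s ^+ 2 / 4 * x * A (mu + 1 + 1) s x.
Proof. by have := besselB_rec (mu + 1) (s ^+ 2 / 4 * x); rewrite addrK. Qed.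

Let v_derive s x : 0 < s -> 0 < x -> is_derive s 1 (fun s => v s x)
  ((c ^+ 2 - c) * (w s / s) * A mu s x - Num.sqrt x * v s x).
Proof.
move=> s0 x0; have dw := w_derive s0.
have dA := A_derive mu s x; have dA1 := A_derive (mu + 1) s x.
apply: is_derive_eq; rewrite /v /GRing.scale/=.
move: (w s) => W.
have xE : x = Num.sqrt x ^+ 2 by rewrite sqr_sqrtr// ltW.
rewrite A_rec /c; move: (A (mu + 1 + 1) s x) (A (mu + 1) s x) (Num.sqrt x) xE => A2 A1 r ->.
by field; rewrite gt_eqF.
Qed.

(** The quotient [v / u]. *)
Let q s x := c / s + (s / 2 * x * A (mu + 1) s x / A mu s x - Num.sqrt x).

Let w_gt0 s : 0 < s -> 0 < w s. Proof. exact: powR_gt0. Qed.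

Let q_CMn n s : 0 < s -> CMn n (q s).
Proof.
move=> s0.
(* Normalized so that [G s] is [q s]. Its derivative in [t] is a nonnegative weight times
   [exp (- (s - t) sqrt x)] times a ratio of [besselB] at the scales [t <= s]. *)
pose G t x := (w s * s * A mu s x)^-1 * (expR (Num.sqrt x * (t - s)) * v t x).
pose g t x := (c ^+ 2 - c) * (w t / t) / (w s * s) *
  (expR (- ((s - t) * Num.sqrt x)) * (A mu t x / A mu s x)).
have ws0 := w_gt0 s0.
have G_derive t x : 0 < t -> 0 < x -> is_derive t 1 (G ^~ x) (g t x).
  move=> t0 x0; have dv := v_derive t0 x0.
  have de0 : is_derive t 1 (fun t => Num.sqrt x * (t - s)) (Num.sqrt x).
    by apply: is_derive_eq; rewrite /GRing.scale/= subr0 mulr1.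
  have de := is_derive1_comp (g := fun t => Num.sqrt x * (t - s)) (is_derive_expR (Num.sqrt x * (t - s))) de0.
  have dev := is_deriveM de dv.
  apply: (is_derive_eq (is_deriveZ (w s * s * A mu s x)^-1 dev)).
  rewrite /GRing.scale/= /g (_ : - ((s - t) * Num.sqrt x) = Num.sqrt x * (t - s)); last by ring.
  field; rewrite !gt_eqF ?A_gt0 //.
have c1 : 1 < c by rewrite /c; move: mu_gt; lra.
have CG e : 0 < e <= s -> CMn n (fun x => G s x - G e x).
  move=> /andP[e0 es]; apply: (@CMn_increment R n G g e s es).
    by move=> t x /andP[et _] x0; apply: G_derive => //; exact: lt_le_trans et.
  move=> t /andP[et ts]; have t0 := lt_le_trans e0 et.
  apply: CMnZ; first by rewrite !mulr_ge0 ?invr_ge0 ?mulr_ge0 ?invr_ge0 ?ltW ?w_gt0//; nra.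
  apply: CMnM; first by apply: expR_sqrt_CMn; rewrite subr_ge0.
  apply: besselB_ratio_CMn => //; first by rewrite divr_gt0 ?exprn_gt0.
  by rewrite ler_pM2r ?invr_gt0// lerXn2r// nnegrE ltW.
apply: (@CMn_ext _ _ (G s)).
  move=> x x0; rewrite /G /q /v subrr mulr0 expR0.
  by field; rewrite !gt_eqF ?A_gt0.
apply: (@CMn_cvg _ n _ (0 : R)^'+ _ (fun e x => G s x - G e x)).
  near=> e; apply: CG; apply/andP; split.
    by near: e; exact: nbhs_right_gt.
  by near: e; exact: nbhs_right_le.
move=> x x0; rewrite -[X in _ --> X]subr0; apply: cvgB; first exact: cvg_cst.
rewrite -[X in _ --> X](mulr0 (w s * s * A mu s x)^-1); apply: cvgMr.
rewrite -[X in _ --> X](mulr0 (expR (Num.sqrt x * (0 - s)))); apply: cvgM.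
  apply: cvg_at_right_filter; apply: continuous_cvg; first exact: continuous_expR.
  by apply: cvgMr; apply: cvgB; [exact: cvg_id|exact: cvg_cst].
have dA := A_derive mu 0 x; have dA1 := A_derive (mu + 1) 0 x.
(* [v t x] is [w t * B t] with [B] continuous at [0], and [w t = t ^ (c - 1)] tends to [0] because
   [c > 1]. *)
pose B t := c * A mu t x + t ^+ 2 * (x / 2) * A (mu + 1) t x - Num.sqrt x * (t * A mu t x).
have B_diff : derivable B 0 1 by exact: ex_derive.
rewrite -[X in _ --> X](mul0r (B 0)); apply: cvgM; first by apply: powR_cvg0; rewrite subr_gt0.
by apply: cvg_at_right_filter; apply: differentiable_continuous; exact/derivable1_diffP.
Unshelve. all: by end_near. Qed.

(** Integration in the scale from [0], where the function is constant in [x], up to [a]. Its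
    derivative in the scale is [q] minus [c / s], which cancels in increments in [x]. *)
Lemma ln_besselB_CMn n a d : 0 <= a -> 0 < d ->
  CMn n (fun x => (ln (besselB mu (a ^+ 2 / 4 * x)) - a * Num.sqrt x) -
     (ln (besselB mu (a ^+ 2 / 4 * (x + d))) - a * Num.sqrt (x + d))).
Proof.
move=> a0 d0.
pose L s x := ln (A mu s x) - s * Num.sqrt x.
pose l s x := s / 2 * x * A (mu + 1) s x / A mu s x - Num.sqrt x.
have L_derive s x : 0 < x -> is_derive s 1 (L ^~ x) (l s x).
  move=> x0; have dl := is_derive1_comp (g := fun s => A mu s x) (is_derive1_ln (A_gt0 s x0)) (A_derive mu s x).
  by apply: is_derive_eq; rewrite /l /GRing.scale/=; ring.
apply: (@CMn_ext _ _ (fun x => (L a x - L a (x + d)) - (L 0 x - L 0 (x + d)))).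
  move=> x x0; rewrite /L /A expr0n/= !mul0r !subr0.
  by rewrite [X in _ - X]subrr subr0.
apply: (@CMn_increment _ _ (fun t x => L t x - L t (x + d)) (fun t x => l t x - l t (x + d))) => //.
  move=> t x _ x0; apply: is_deriveB; first exact: L_derive.
  by apply: L_derive; rewrite addr_gt0.
(* At [t = 0] the term [c / t] of [q] is meaningless; there [l] is just [- sqrt x]. *)
move=> t /andP[]; rewrite le_eqVlt => /predU1P[<- _|t0 _].
  apply: (CMn_ext _ (CMn_sqrt n d0)) => x _.
  by rewrite /l !mul0r; ring.
have [_ /(_ d d0)] := q_CMn n.+1 t0; apply: CMn_ext => x _.
by rewrite /q /l; ring.
Qed.

End bessel_first_kind_log.

Lemma nonincreasing_le_cvg0 (R : realType) (f : R -> R) (l : R) :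
  (forall x d, 0 < x -> 0 < d -> f (x + d) <= f x) ->
  f x @[x --> 0^'+] --> l -> forall x, 0 < x -> f x <= l.
Proof.
move=> f_le fl x x0; apply: (cvgr_to_ge fl); near=> e.
have e0 : 0 < e by near: e; exact: nbhs_right_gt.
have ex : e < x by near: e; exact: nbhs_right_lt.
by rewrite -(subrKC e x) f_le// subr_gt0.
Unshelve. all: by end_near. Qed.

Lemma powR_div2 (R : realType) (z r : R) : 0 <= z -> (z / 2) `^ r = z `^ r / 2 `^ r.
Proof. by move=> z0; rewrite powRM ?invr_ge0// -powR_inv1// -powRrM mulN1r powRN. Qed.

Lemma laplace_ge_atom (R : realType) (P : probability (measurableTypeR R) R) (x : R) :
  0 < x -> fine (P [set 0]) <= laplace P x.
Proof.
move=> x0; rewrite /laplace /Rintegral.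
pose e (t : R) := (expR (- (x * t)))%:E; pose D : set R := `[0, +oo[%classic.
have m_e A : measurable_fun A (e : measurableTypeR R -> \bar R).
  apply: measurable_funTS; apply/measurable_EFinP; apply: measurableT_comp => //.
  by apply: measurableT_comp => //; exact: measurable_funM.
have e_ge0 t : (0 <= e t)%E by rewrite lee_fin expR_ge0.
have mD : measurable (D : set (measurableTypeR R)) by exact: measurable_itv.
have e_le : (\int[P]_(t in D) e t <= 1)%E.
  apply: (@le_trans _ _ (\int[P]_(t in D) (cst 1%E t))%E).
    apply: ge0_le_integral => //.
    by move=> t; rewrite /D/= in_itv/= andbT => t0; rewrite lee_fin -expR0 ler_expR oppr_le0 mulr_ge0// ltW.
  by rewrite integral_cst// mul1e probability_le1.
have e_ge : (P [set (0 : R)%R] <= \int[P]_(t in D) e t)%E.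
  rewrite -[leLHS]mul1e -integral_cst//.
  apply: (@le_trans _ _ (\int[P]_(t in [set (0 : R)%R]) e t)%E).
    rewrite le_eqVlt; apply/orP; left; apply/eqP; apply: eq_integral => t.
    by rewrite inE/= => ->; rewrite /e mulr0 oppr0 expR0.
  apply: ge0_subset_integral => // t /= ->.
  by rewrite /D/= in_itv/= lexx.
apply: fine_le => //; first exact: fin_num_measure.
by rewrite ge0_fin_numE ?integral_ge0// (le_lt_trans e_le)// ltry.
Qed.

(** * The distribution of [chi] *)

Section chi_distribution.
Context {R : realType}.
Variables (a b nu mu : R).
Hypotheses (a_gt0 : 0 < a) (b_gt0 : 0 < b) (nu_gt0 : 0 < nu) (mu_gt : 1 / 2 < mu).
Implicit Types (n : nat) (x d k : R).

Let mu_gtN1 : -1 < mu.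
Proof. by move: mu_gt; lra. Qed.

Let Gamma_mu : 0 < Gamma (mu + 1).
Proof. by rewrite Gamma_gt0//; move: mu_gt; lra. Qed.

Let Gamma_nu : 0 < Gamma nu.
Proof. exact: Gamma_gt0. Qed.

Let LI x := ln (Gamma (mu + 1)) + (ln (besselB mu (a ^+ 2 / 4 * x)) - a * Num.sqrt x).
Let LK x := ln (gintegral nu (b ^+ 2 / 4 * x)) - ln (Gamma nu).

Let b2_gt0 : 0 < b ^+ 2 / 4.
Proof. by rewrite divr_gt0 ?exprn_gt0. Qed.

Let B_gt0 x : 0 < x -> 0 < besselB mu (a ^+ 2 / 4 * x).
Proof. by move=> x0; rewrite besselB_gt0// mulr_ge0 ?divr_ge0 ?sqr_ge0// ltW. Qed.

Let g_gt0 x : 0 < x -> 0 < gintegral nu (b ^+ 2 / 4 * x).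
Proof. by move=> x0; rewrite gintegral_gt0 ?nu_gt0 ?orbT// ltW// mulr_gt0. Qed.

(** The powers of [x] and of [a], [b], [2] in the Bessel functions cancel against the prefactor; the
    last [2] cancels the [1 / 2] of [besselKE]. *)
Let chiE x : 0 < x -> chi mu nu a b x = expR (LI x) * expR (LK x).
Proof.
move=> x0; have s0 : 0 < Num.sqrt x by rewrite sqrtr_gt0.
rewrite /LI /LK !(expRD, expRB, expRN) !lnK ?posrE ?B_gt0 ?g_gt0//.
rewrite /chi ?expRN besselIE ?mulr_gt0// besselKE ?mulr_gt0//.
rewrite !exprMn sqr_sqrtr ?(ltW x0)//.
rewrite [a ^+ 2 / 4 * x]mulrAC [b ^+ 2 / 4 * x]mulrAC.
have -> : x `^ ((nu - mu) / 2) = Num.sqrt x `^ nu / Num.sqrt x `^ mu.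
  by rewrite -powRB ?(gt_eqF s0) ?implybT// -powR12_sqrt ?(ltW x0)// -powRrM [in RHS]mulrC.
have -> : 2 `^ (mu - nu + 1) = 2 `^ mu / 2 `^ nu * 2 :> R.
  by rewrite !gt0_powRD// powRN powRr1.
rewrite !powR_div2 ?mulr_ge0 ?(ltW a_gt0) ?(ltW b_gt0) ?(ltW s0)//.
rewrite !powRN !powRM ?(ltW a_gt0) ?(ltW b_gt0) ?(ltW s0)//.
have p0 y p : 0 < y -> y `^ p != 0 :> R by move=> y0; rewrite gt_eqF ?powR_gt0.
have [[[a0 b0] s0'] t0] := (p0 _ mu a_gt0, p0 _ nu b_gt0, p0 _ nu s0, p0 _ mu s0).
have [t1 t2] := (p0 2 mu (ltr0Sn _ 1), p0 2 nu (ltr0Sn _ 1)).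
move: a0 b0 s0' t0 t1 t2 Gamma_nu Gamma_mu (expR_gt0 (a * Num.sqrt x)).
move: (a `^ mu) (b `^ nu) (Num.sqrt x `^ nu) (Num.sqrt x `^ mu) (2 `^ mu) (2 `^ nu)
  (Gamma nu) (Gamma (mu + 1)) (expR (a * Num.sqrt x)) (besselB _ _) (gintegral _ _).
move=> A B S T U V G1 G2 E F g A0 B0 S0 T0 U0 V0 G10 G20 E0.
by field; rewrite V0 B0 S0 A0 T0 U0 !gt_eqF.
Qed.

Let LI_CMn n d : 0 < d -> CMn n (fun x => LI x - LI (x + d)).
Proof.
move=> d0; apply: (CMn_ext _ (ln_besselB_CMn mu_gt n (ltW a_gt0) d0)) => x _.
by rewrite /LI [X in _ = X - _]addrC addrKA.
Qed.

Let LK_CMn n d : 0 < d -> CMn n (fun x => LK x - LK (x + d)).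
Proof.
move=> d0; apply: (CMn_ext _ (ln_gintegral_CMn n nu_gt0 b2_gt0 d0)) => x _.
by rewrite /LK opprB addrA subrK.
Qed.

Let LI_cvg0 : LI x @[x --> 0^'+] --> (0 : R).
Proof.
have e : ln (Gamma (mu + 1)) + (ln (besselB mu 0) - a * 0) = 0.
  by rewrite besselB0 lnV ?posrE// mulr0 subr0 subrr.
rewrite -[X in _ --> X]e.
apply: cvgD; first exact: cvg_cst.
apply: cvgB; last first.
  apply: cvgMr; apply: cvg_at_right_filter.
  by rewrite -[X in _ --> X](@sqrtr0 R); exact: sqrt_continuous.
apply: (@continuous_cvg _ _ _ _ _ (fun x => besselB mu (a ^+ 2 / 4 * x)) (@ln R)).
  by apply: continuous_ln; rewrite besselB_gt0.
apply: cvg_at_right_filter.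
apply: (@continuous_cvg _ _ _ _ _ (fun x => a ^+ 2 / 4 * x) (besselB mu)).
  exact: is_derive1_continuous (besselB_derive mu 0).
by rewrite -[X in _ --> X](mulr0 (a ^+ 2 / 4)); apply: cvgMr; exact: cvg_id.
Qed.

Let LK_cvg0 : LK x @[x --> 0^'+] --> (0 : R).
Proof.
rewrite -[X in _ --> X](subrr (ln (Gamma nu))); apply: cvgB; last exact: cvg_cst.
rewrite Gamma_gintegral//.
apply: (@continuous_cvg _ _ _ _ _ (fun x => gintegral nu (b ^+ 2 / 4 * x)) (@ln R)).
  by apply: continuous_ln; rewrite -Gamma_gintegral.
apply: (cvg_comp _ _ _ (gintegral_cvg0 nu_gt0)).
apply: cvg_at_right0; last first.
  by near=> x; rewrite mulr_gt0//; near: x; exact: nbhs_right_gt.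
rewrite -[X in _ --> X](mulr0 (b ^+ 2 / 4)); apply: cvgMr.
by apply: cvg_at_right_filter; exact: cvg_id.
Unshelve. all: by end_near. Qed.

Let LI_le0 x : 0 < x -> LI x <= 0.
Proof.
apply: (nonincreasing_le_cvg0 _ LI_cvg0) => {}x d x0 d0.
by rewrite -subr_ge0; exact: (CMn_ge0 (LI_CMn 0 d0)).
Qed.

Let LK_le0 x : 0 < x -> LK x <= 0.
Proof.
apply: (nonincreasing_le_cvg0 _ LK_cvg0) => {}x d x0 d0.
by rewrite -subr_ge0; exact: (CMn_ge0 (LK_CMn 0 d0)).
Qed.

Let LI_continuous x : 0 < x -> {for x, continuous LI}.
Proof.
move=> x0; apply: cvgD; first exact: cvg_cst.
apply: cvgB; last by apply: cvgMr; exact: sqrt_continuous.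
apply: (@continuous_cvg _ _ _ _ _ (fun x => besselB mu (a ^+ 2 / 4 * x)) (@ln R)).
  by apply: continuous_ln; exact: B_gt0.
apply: (@continuous_cvg _ _ _ _ _ (fun x => a ^+ 2 / 4 * x) (besselB mu)).
  exact: is_derive1_continuous (besselB_derive mu _).
by apply: cvgMr; exact: cvg_id.
Qed.

Let LK_continuous x : 0 < x -> {for x, continuous LK}.
Proof.
move=> x0; apply: cvgB; last exact: cvg_cst.
apply: (@continuous_cvg _ _ _ _ _ (fun x => gintegral nu (b ^+ 2 / 4 * x)) (@ln R)).
  by apply: continuous_ln; exact: g_gt0.
apply: (@continuous_cvg _ _ _ _ _ (fun x => b ^+ 2 / 4 * x) (gintegral nu)).
  by apply: is_derive1_continuous (gintegral_derive nu _); rewrite mulr_gt0.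
by apply: cvgMr; exact: cvg_id.
Qed.

(** Used with [k = 1] for the measure and [k = 1 / n] for its convolution roots. *)
Let chi_root k : 0 <= k -> exists P : probability (measurableTypeR R) R,
  P `[0, +oo[%classic = 1%E /\
  forall x, 0 < x -> laplace P x = expR (k * (LI x + LK x)).
Proof.
move=> k0; apply: bernstein.
- move=> n; apply: CMnS.
  apply: (@CMn_ext _ _ (fun x => expR (- - (k * (LI x + LK x))))) => [x _|].
    by rewrite opprK.
  apply: CMn_expRN => d d0.
  apply: (@CMn_ext _ _ (fun x => k * ((LI x - LI (x + d)) + (LK x - LK (x + d))))).
    by move=> x _; move: (LI x) (LI (x + d)) (LK x) (LK (x + d)) => *; ring.
  by apply: CMnZ => //; apply: CMnD; [exact: LI_CMn|exact: LK_CMn].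
- move=> x x0; rewrite -expR0 ler_expR mulr_ge0_le0//.
  by rewrite -[leRHS]addr0 lerD ?LI_le0 ?LK_le0.
- move=> x x0; apply: (@continuous_cvg _ _ _ _ _ (fun x => k * (LI x + LK x)) (@expR R)).
    exact: continuous_expR.
  by apply: cvgMr; apply: cvgD; [exact: LI_continuous|exact: LK_continuous].
- rewrite -expR0.
  apply: (@continuous_cvg _ _ _ _ _ (fun x => k * (LI x + LK x)) (@expR R)).
    exact: continuous_expR.
  rewrite -[X in _ --> X](mulr0 k) -[X in k * X](addr0 0).
  by apply: cvgMr; apply: cvgD; [exact: LI_cvg0|exact: LK_cvg0].
Qed.

(** The first factor is at most [1]; the second decays by [gintegral_le] with [k = 0]. *)
Let chi_le x : 0 < x ->
  chi mu nu a b x <= gintegral (nu + 1) 0 / (b ^+ 2 / 4 * Gamma nu) / x.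
Proof.
move=> x0; rewrite chiE// -[leRHS]mul1r.
apply: ler_pM; rewrite ?expR_ge0//; first by rewrite -expR0 ler_expR LI_le0.
rewrite /LK expRB !lnK ?posrE ?g_gt0//.
have bx0 : 0 < b ^+ 2 / 4 * x by rewrite mulr_gt0.
have nu1 : 0 < nu + 1%:R by rewrite addr_gt0.
have := gintegral_le (k := 0) bx0 nu1; rewrite expr1 (_ : 1`!%N = 1%N)// => h.
rewrite ler_pdivrMr//; apply: (le_trans h).
move: (gintegral (nu + 1%:R) 0) (Gamma nu) Gamma_nu b2_gt0 => M G G0 B0.
rewrite le_eqVlt; apply/orP; left; apply/eqP; field.
by rewrite !gt_eqF.
Qed.

Lemma chi_laplace : exists P : probability (measurableTypeR R) R,
  [/\ P `]0, +oo[%classic = 1%E,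
      infinitely_divisible P &
      forall x : R, 0 < x -> laplace P x = chi mu nu a b x].
Proof.
have [P [P1 LP]] := chi_root ler01.
have Pchi x : 0 < x -> laplace P x = chi mu nu a b x.
  by move=> x0; rewrite LP// chiE// mul1r expRD.
exists P; split => // [|n n0].
  (* The atom at [0] is a lower bound of the Laplace transform; at [x = n + 1] the latter is at most
     a constant over [n + 1]. *)
  have P0 : fine (P [set 0]) <= 0.
    apply: (@le0_harmonic R _ (gintegral (nu + 1) 0 / (b ^+ 2 / 4 * Gamma nu))) => n.
    apply: le_trans (chi_le (ltr0Sn _ n)).
    by rewrite -Pchi ?ltr0Sn//; apply: laplace_ge_atom; exact: ltr0Sn.
  have m0 : measurable ([set (0 : R)] : set (measurableTypeR R)) by exact: measurable_set1.
  have mD : measurable (`]0, +oo[%classic : set (measurableTypeR R)) by exact: measurable_itv.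
  have PE0 : P [set (0 : R)] = 0%E.
    apply/eqP; rewrite eq_le measure_ge0 andbT -[leLHS]fineK ?lee_fin//.
    exact: fin_num_measure.
  rewrite -P1 -(@setU1itv _ _ _ _ false)//.
  have -> := measureU P m0 mD _; first by rewrite [X in (X + _)%E]PE0 add0e.
  by apply/seteqP; split => // t [] /= ->; rewrite in_itv/= ltxx.
have [Q [Q1 LQ]] := chi_root (ltW (divr_gt0 ltr01 (ltr0Sn R n.-1))).
exists Q; split => // x x0.
rewrite LP// LQ// -expRM_natl prednK//; congr expR.
by rewrite mulrA [n%:R * _]mulrC divfK// pnatr_eq0 -lt0n.
Qed.

End chi_distribution.

Theorem theorem14 (R : realType) (a b nu mu : R)
    (a_gt0 : 0 < a) (b_gt0 : 0 < b) (nu_gt0 : 0 < nu) (mu_gt : 1 / 2 < mu) :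
  exists P : probability (measurableTypeR R) R,
    [/\ P `]0, +oo[%classic = 1%E,
        infinitely_divisible P &
        forall x : R, 0 < x -> laplace P x = chi mu nu a b x].
Proof. exact: chi_laplace. Qed.
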